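(* Let $(A,\mathcal{D})$ be a digit system with $b\geqslant 2$, and let $\mathcal{F}=\mathcal{F}(A,\mathcal{D})\subset\mathbb{K}_A$. Then $\mathcal{F}$ has positive measure, i.e. $\mu(\mathcal{F})>0$, if and only if both of the following hold: for every $k\geqslant 1$, all $a^k$ expansions $d_0+Ad_1+\dots+A^{k-1}d_{k-1}$ with $(d_0,\dots,d_{k-1})\in\mathcal{D}^k$ are pairwise distinct; and $\varphi(\mathcal{D}_\infty)$ is a uniformly discrete subset of $\mathbb{K}_A$.
   Context: Let $n\geqslant 1$ and let $A\in\mathbb{Q}^{n\times n}$ be expanding (all eigenvalues have absolute value $>1$); put $B:=A^{-1}$. For an invertible $M\in\mathbb{Q}^{n\times n}$ let $\mathbb{Z}^n[M]:=\bigcup_{k\geqslant 1}(\mathbb{Z}^n+M\mathbb{Z}^n+\dots+M^{k-1}\mathbb{Z}^n)$. Put $a:=|\mathbb{Z}^n[A]/A\mathbb{Z}^n[A]|$ and $b:=|\mathbb{Z}^n[B]/B\mathbb{Z}^n[B]|$ (both finite). Representation space: let $\mathbb{Z}^n(B):=\bigcup_{k\geqslant 1}(B^{-k}\mathbb{Z}^n+B^{-k+1}\mathbb{Z}^n+\dots+B^k\mathbb{Z}^n)$. For $y\in\mathbb{Z}^n(B)$ let $\nu(y):=\inf\{k\in\mathbb{Z} : y\notin B^{k+1}\mathbb{Z}^n[B]\}\in\mathbb{Z}\cup\{\infty\}$ (with $\inf\varnothing=\infty$), and ${\bf d}_B(y,y'):=b^{-\nu(y-y')}$, with $b^{-\infty}=0$.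 $\mathbb{Z}^n((B))$ is the completion of $\mathbb{Z}^n(B)$ with respect to ${\bf d}_B$ (points at distance $0$ being identified); the group structure, $\nu$, ${\bf d}_B$ and multiplication by $A$ and $B$ extend to it, and elements of $\mathbb{Z}^n(B)$ are regarded as elements of $\mathbb{Z}^n((B))$ via the canonical map. $\mathbb{Z}^n[[B]]:=\{y\in\mathbb{Z}^n((B)):\nu(y)\geqslant 0\}$, and $\mu_B$ is the Haar measure on $\mathbb{Z}^n((B))$ with $\mu_B(\mathbb{Z}^n[[B]])=1$. Let $\mathbb{K}_A:=\mathbb{R}^n\times\mathbb{Z}^n((B))$, with metric ${\bf d}((x,y),(x',y')):=\max\{\|x-x'\|,{\bf d}_B(y,y')\}$ ($\|\cdot\|$ Euclidean) and Haar measure $\mu:=\lambda\times\mu_B$, $\lambda$ being Lebesgue measure. $A$ acts by $A(x,y)=(Ax,Ay)$. Let $\varphi:\mathbb{Z}^n(B)\to\mathbb{K}_A$, $\varphi(x)=(x,x)$. A digit system is a pair $(A,\mathcal{D})$ with $A\in\mathbb{Q}^{n\times n}$ expanding and $\mathcal{D}\subset\mathbb{Z}^n[A]$, $|\mathcal{D}|=a$. $\mathcal{F}(A,\mathcal{D})\subset\mathbb{K}_A$ is the unique nonempty compact set with $A\mathcal{F}=\bigcup_{d\in\mathcal{D}}(\mathcal{F}+\varphi(d))$; explicitly $\mathcal{F}=\{\sum_{j\geqslant1}A^{-j}\varphi(d_j): d_j\in\mathcal{D}\}$. $\mathcal{D}_k:=\{d_0+Ad_1+\dots+A^{k-1}d_{k-1}: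 d_0,\dots,d_{k-1}\in\mathcal{D}\}$ and $\mathcal{D}_\infty:=\bigcup_{k\geqslant 1}\mathcal{D}_k$. A set $M\subset\mathbb{K}_A$ is uniformly discrete if there is $r>0$ such that every open ball of radius $r$ in $\mathbb{K}_A$ contains at most one point of $M$. *)

(* Defs.v *)
From HB Require Import structures.
From mathcomp Require Import all_boot all_order all_algebra all_field.
From mathcomp Require Import finmap.
From mathcomp Require Import all_classical all_reals all_analysis.

Set Implicit Arguments.
Unset Strict Implicit.
Unset Printing Implicit Defensive.

Import Order.TTheory GRing.Theory Num.Theory.
Import numFieldNormedType.Exports.

Local Open Scope classical_set_scope.
Local Open Scope ring_scope.

(* Eigenvalues are complex, and algebraic since [A] is rational. *)
Definition expanding n (A : 'M[rat]_n) : Prop :=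
  forall z : algC, eigenvalue (map_mx ratr A) z -> 1 < `|z|.

Lemma expanding_unit n (A : 'M[rat]_n.+1) : expanding A -> A \is a GRing.unit.
Proof.
move=> hA; apply: contraT => nuA.
have : eigenvalue (map_mx ratr A : 'M[algC]_n.+1) 0.
  rewrite eigenvalue_root_char rootE horner_coef0 char_poly_det.
  have -> : \det (map_mx ratr A : 'M[algC]_n.+1) = 0.
    rewrite det_map_mx.
    have -> : \det A = 0.
      apply/eqP; apply: contraNT nuA => dA.
      by rewrite -[_ \is a _]/(A \in unitmx) unitmxE unitfE.
    by rewrite rmorph0.
  by rewrite mulr0.
by move/hA; rewrite normr0 ltr10.
Qed.

Section Lattices.
Variable n : nat.
Implicit Types (M : 'M[rat]_n.+1) (x y : 'cV[rat]_n.+1) (k : int).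

Definition zvec (z : 'cV[int]_n.+1) : 'cV[rat]_n.+1 := map_mx intr z.

(* [Z^n + M Z^n + ... + M^(m-1) Z^n] *)
Definition Zspan M (m : nat) : set 'cV[rat]_n.+1 :=
  [set \sum_(i < m) (M ^+ i) *m zvec (z i) | z in [set: nat -> 'cV[int]_n.+1]].

(* [Z^n[M]] *)
Definition Zpoly M : set 'cV[rat]_n.+1 :=
  \bigcup_(m in [set m | (1 <= m)%N]) Zspan M m.

(* [Z^n(M)]: the union over [m >= 1] of [M^-m Z^n + ... + M^m Z^n] *)
Definition Zlaurent M : set 'cV[rat]_n.+1 :=
  \bigcup_(m in [set m | (1 <= m)%N])
    [set \sum_(i < m.*2.+1) (M ^ (i%:Z - m%:Z)) *m zvec (z i)
      | z in [set: nat -> 'cV[int]_n.+1]].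

Definition cosets M : set (set 'cV[rat]_n.+1) :=
  [set [set x + M *m y | y in Zpoly M] | x in Zpoly M].

(* The order of [Z^n[M] / M Z^n[M]]. [fset_set] is empty on infinite sets, but
   for invertible [M] the set of cosets is finite, see [finite_cosets]. *)
Definition quot_card M : nat := #|` fset_set (cosets M)|.

(* [M^k Z^n[M]] *)
Definition level M k : set 'cV[rat]_n.+1 :=
  [set (M ^ k) *m x | x in Zpoly M].

Lemma Zspan0 M m : Zspan M m 0.
Proof.
exists (fun=> 0) => //; rewrite big1// => i _.
by rewrite /zvec map_mx0 mulmx0.
Qed.

Lemma ZspanB M m x y : Zspan M m x -> Zspan M m y -> Zspan M m (x - y).
Proof.
move=> [z _ <-] [w _ <-]; exists (fun i => z i - w i) => //.
by rewrite -sumrB; apply: eq_bigr => i _; rewrite /zvec map_mxB mulmxBr.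
Qed.

Lemma Zspan_le M m m' : (m <= m')%N -> Zspan M m `<=` Zspan M m'.
Proof.
move=> le_mm' _ [z _ <-]; exists (fun i => if (i < m)%N then z i else 0) => //.
rewrite (big_ord_widen m' (fun i => M ^+ i *m zvec (z i)) le_mm').
rewrite [RHS]big_mkcond/=; apply: eq_bigr => i _; case: ifP => // _.
by rewrite /zvec map_mx0 mulmx0.
Qed.

Lemma Zspan_mul M m x : Zspan M m x -> Zspan M m.+1 (M *m x).
Proof.
move=> [z _ <-]; exists (fun i => if i is j.+1 then z j else 0) => //.
rewrite big_ord_recl/= /zvec map_mx0 mulmx0 add0r mulmx_sumr.
by apply: eq_bigr => i _; rewrite mulmxA exprS.
Qed.

Lemma ZpolyP M x : Zpoly M x <-> exists m, Zspan M m x.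
Proof.
split=> [[m _ mx]|[m mx]]; first by exists m.
by exists m.+1 => //; apply: Zspan_le mx.
Qed.

Lemma Zpoly0 M : Zpoly M 0.
Proof. by apply/ZpolyP; exists 0%N; exact: Zspan0. Qed.

Lemma ZpolyB M x y : Zpoly M x -> Zpoly M y -> Zpoly M (x - y).
Proof.
move=> /ZpolyP[m mx] /ZpolyP[m' my]; apply/ZpolyP; exists (maxn m m').
by apply: ZspanB; [apply: Zspan_le mx; exact: leq_maxl|
  apply: Zspan_le my; exact: leq_maxr].
Qed.

Lemma Zpoly_mul M x : Zpoly M x -> Zpoly M (M *m x).
Proof. by move=> /ZpolyP[m mx]; apply/ZpolyP; exists m.+1; exact: Zspan_mul. Qed.

Lemma level0 M k : level M k 0.
Proof. by exists 0; [exact: Zpoly0|rewrite mulmx0]. Qed.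

Lemma levelB M k x y : level M k x -> level M k y -> level M k (x - y).
Proof.
move=> [u hu <-] [v hv <-]; exists (u - v); first exact: ZpolyB.
by rewrite mulmxBr.
Qed.

Lemma levelN M k x : level M k x -> level M k (- x).
Proof. by move=> hx; rewrite -sub0r; apply: levelB => //; exact: level0. Qed.

Lemma levelD M k x y : level M k x -> level M k y -> level M k (x + y).
Proof. by move=> hx hy; rewrite -[y]opprK; apply: levelB => //; exact: levelN. Qed.

Section Unit.
Variable M : 'M[rat]_n.+1.
Hypothesis uM : M \is a GRing.unit.

Lemma level_mul j k x : level M k x -> level M (j + k) ((M ^ j) *m x).
Proof.
by move=> [u hu <-]; exists u => //; rewrite mulmxA mulmxE -exprzDr.
Qed.

Lemma level_mulE j k x : level M (j + k) ((M ^ j) *m x) <-> level M k x.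
Proof.
split=> [h|]; last exact: level_mul.
have := level_mul (- j) h.
by rewrite mulmxA mulmxE -exprzDr// addNr addKr expr0z mul1mx.
Qed.

Lemma level_le j k : j <= k -> level M k `<=` level M j.
Proof.
move=> jk x.
have [m ->] : exists m : nat, k = j + m%:Z.
  by exists `|k - j|%N; rewrite gez0_abs ?subr_ge0// [RHS]addrC subrK.
elim: m x => [|m ih] x; first by rewrite addr0.
rewrite intS addrCA => -[u hu <-]; apply: ih.
exists (M *m u); first exact: Zpoly_mul.
by rewrite mulmxA mulmxE -[in X in _ * X](expr1z M) -exprzDr// addrC.
Qed.

Lemma ZlaurentP x : Zlaurent M x <-> exists k, level M k x.
Proof.
have shift m (z : nat -> 'cV[int]_n.+1) :
    \sum_(i < m.*2.+1) (M ^ (i%:Z - m%:Z)) *m zvec (z i) =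
    (M ^ (- m%:Z)) *m \sum_(i < m.*2.+1) (M ^+ i) *m zvec (z i).
  rewrite mulmx_sumr; apply: eq_bigr => i _.
  by rewrite mulmxA mulmxE -[M ^+ i]/(M ^ i%:Z) -exprzDr// addrC.
split=> [[m _ [z _ <-]]|[k kx]].
  exists (- m%:Z); rewrite shift; eexists; last reflexivity.
  by apply/ZpolyP; exists m.*2.+1, z.
have {}kx : level M (- `|k|%N%:Z) x.
  by apply: level_le kx; rewrite lerNl; have := ler_norm (- k); rewrite normrN.
move: kx => [u /ZpolyP[m mu] <-]; set j := `|k|%N.
pose p := (maxn 1 (maxn j m)).
have jp : (j <= p)%N by rewrite /p !leq_max leqnn !orbT.
have mp : (m <= p)%N by rewrite /p !leq_max leqnn !orbT.
have iterS q : Zspan M (q + m) ((M ^+ q) *m u).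
  elim: q => [|q ih]; first by rewrite expr0 mul1mx.
  by rewrite exprS -mulmxE -mulmxA addSn; exact: Zspan_mul.
exists p; first by rewrite /= leq_maxl.
have [z _ hz] : Zspan M p.*2.+1 ((M ^+ (p - j)) *m u).
  by apply: Zspan_le (iterS _); rewrite -addnn ltnW// ltnS leq_add// leq_subr.
exists z => //; rewrite shift hz mulmxA mulmxE -[M ^+ _]/(M ^ (p - j)%N%:Z).
by rewrite -exprzDr// -subzn// addKr.
Qed.

Lemma Zlaurent0 : Zlaurent M 0.
Proof. by apply/ZlaurentP; exists 0; exact: level0. Qed.

Lemma ZlaurentB x y : Zlaurent M x -> Zlaurent M y -> Zlaurent M (x - y).
Proof.
move=> /ZlaurentP[j jx] /ZlaurentP[k ky]; apply/ZlaurentP; exists (Num.min j k).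
by apply: levelB; [apply: level_le jx|apply: level_le ky];
  rewrite ge_min lexx ?orbT.
Qed.

Lemma Zlaurent_mul k x : Zlaurent M x -> Zlaurent M ((M ^ k) *m x).
Proof.
by move=> /ZlaurentP[j jx]; apply/ZlaurentP; exists (k + j); exact: level_mul.
Qed.

End Unit.
End Lattices.

Lemma finite_cosets n (M : 'M[rat]_n.+1) :
  M \is a GRing.unit -> finite_set (cosets M).
Proof.
move=> uM; pose C := M^-1.
pose N := \prod_(p : 'I_n.+1 * 'I_n.+1) denq (C p.1 p.2).
have N0 : N != 0 by apply/prodf_neq0 => p _; exact: denq_neq0.
have CN i j : N%:~R * C i j \is a Num.int.
  by rewrite /N (bigD1 (i, j))//= intrM mulrAC [_ * C i j]mulrC -numqE rpredM ?intr_int.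
have NC (z : 'cV[int]_n.+1) : exists w, N%:~R *: zvec z = M *m zvec w.
  have h i : N%:~R * (C *m zvec z) i 0 \is a Num.int.
    rewrite mxE mulr_sumr; apply: rpred_sum => j _.
    by rewrite mulrA mxE rpredM ?intr_int.
  exists (\col_i Num.floor (N%:~R * (C *m zvec z) i 0)).
  have -> : zvec (\col_i Num.floor (N%:~R * (C *m zvec z) i 0)) =
      N%:~R *: (C *m zvec z).
    by apply/matrixP => i j; rewrite !mxE !ord1 floorK//; have := h i; rewrite mxE.
  by rewrite -scalemxAr mulmxA mulmxE divrr// mul1mx.
pose cos x : set 'cV[rat]_n.+1 := [set x + M *m y | y in Zpoly M].
have cosD x y : Zpoly M y -> cos (x + M *m y) = cos x.
  move=> hy; apply/seteqP; split=> _ [v hv <-].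
    exists (y + v); last by rewrite mulmxDr addrA.
    rewrite -[v]opprK -[- v]sub0r.
    by apply: ZpolyB => //; apply: ZpolyB => //; exact: Zpoly0.
  exists (v - y); first exact: ZpolyB.
  by rewrite mulmxBr -addrA [M *m y + _]addrC subrK.
have intP (z : 'cV[int]_n.+1) : Zpoly M (zvec z).
  apply/ZpolyP; exists 1%N; exists (fun=> z) => //.
  by rewrite big_ord1 expr0 mul1mx.
pose f (r : 'cV['I_(`|N|.+1)]_n.+1) := cos (zvec (map_mx (fun i : 'I_(`|N|.+1) => i%:Z) r)).
apply: (@sub_finite_set _ _ (range f)); last exact/finite_image/finite_finset.
move=> _ [x [m /= m1 [z _ <-]] <-].
have [y hy ->] : exists2 y, Zpoly M y &
    \sum_(i < m) M ^+ i *m zvec (z i) = zvec (z 0%N) + M *m y.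
  exists (\sum_(i < m.-1) M ^+ i *m zvec (z i.+1)).
    by exists m => //; apply: (@Zspan_le _ _ m.-1); [exact: leq_pred|exists (z \o succn)].
  case: m m1 => // m _; rewrite big_ord_recl expr0 mul1mx mulmx_sumr /=.
  by congr (_ + _); apply: eq_bigr => i _; rewrite mulmxA exprS.
rewrite -/(cos _) cosD//.
pose r := \col_i (inord `|modz (z 0%N i ord0) N|%N : 'I_(`|N|.+1)).
exists r => //; rewrite /f.
pose q : 'cV[int]_n.+1 := \col_i divz (z 0%N i ord0) N.
have [w hw] := NC q.
rewrite -(cosD _ (zvec w))// -hw; congr cos; apply/matrixP => i j.
rewrite !mxE ord1 inordK; last first.
  rewrite ltnS -lez_nat abszE ger0_norm ?modz_ge0//.
  by rewrite abszE ltW// -[X in _ < `|X|]mul1r mul1r ltz_mod.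
rewrite abszE ger0_norm ?modz_ge0// -intrM -intrD.
by rewrite [in LHS]mulrC [in LHS]addrC -divz_eq !ord1.
Qed.

(* The matrices over which the representation space is built; the two proofs
   are what makes [dB] below a pseudometric. *)
Record base n := Base {
  mxA : 'M[rat]_n.+1 ;
  base_expanding : expanding mxA ;
  base_card : (2 <= quot_card mxA^-1)%N }.

Definition mxB n (A : base n) : 'M[rat]_n.+1 := (mxA A)^-1.

Lemma mxB_unit n (A : base n) : mxB A \is a GRing.unit.
Proof. by rewrite unitrV; exact/expanding_unit/base_expanding. Qed.

Section Valuation.
Variables (R : realType) (n : nat) (A : base n).
Implicit Types (x y z : 'cV[rat]_n.+1) (k : int).

Let B := mxB A.
Let uB : B \is a GRing.unit := mxB_unit A.

Definition base_b : nat := quot_card (mxB A).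

Definition nu y : \bar R :=
  ereal_inf [set (k%:~R)%:E | k in [set k : int | ~ level (mxB A) (k + 1) y]].

(* [b ^ (- v)]. The value at [-oo] is junk: [nu] never takes it on [Z^n(B)],
   see [nuP]. *)
Definition bexp (v : \bar R) : R :=
  if v is r%:E then base_b%:R `^ (- r) else 0.

Definition dB y y' : R := bexp (nu (y - y')).

Lemma base_b_gt1 : (1 : R) < base_b%:R.
Proof. by rewrite ltr1n; exact: base_card. Qed.

Variant nu_spec y : \bar R -> R -> Prop :=
| NuInfty of (forall k, level B k y) : nu_spec y +oo%E 0
| NuFin k of (forall j, level B j y <-> j <= k) :
    nu_spec y (k%:~R)%:E (base_b%:R ^ (- k)).

Lemma nuP y : Zlaurent B y -> nu_spec y (nu y) (bexp (nu y)).
Proof.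
move=> /(ZlaurentP uB)[m my].
have [ally|] := pselect (forall k, level B k y).
  have -> : nu y = +oo%E.
    rewrite /nu (_ : [set _ | _ in _] = set0) ?ereal_inf0//.
    by rewrite -subset0 => _ [k nk <-]; exact: nk (ally _).
  by constructor.
move=> /existsNP[k0 nk0].
have hk : exists i : nat, `[< ~ level B (m + i%:Z + 1) y >].
  exists `|k0 - m|%N; apply/asboolP => h; apply: nk0; apply: level_le h => //.
  by rewrite ler_wpDr// -lerBlDl; exact: lez_abs.
case: (ex_minnP hk) => i /asboolP ni imin.
have ky : level B (m + i%:Z) y.
  case: i ni imin => [|i] ni imin; first by rewrite addr0.
  apply: contrapT => nki; have := imin i.
  rewrite ltnn => himin; suff: false by [].
  by apply: himin; apply/asboolP; rewrite -addrA -[i%:Z + 1]PoszD addn1.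
pose k := m + i%:Z.
have kP j : level B j y <-> j <= k.
  split=> [jy|jk]; last by apply: level_le ky.
  rewrite leNgt; apply/negP => kj; apply: ni; apply: level_le jy => //.
  by rewrite lezD1.
have nuE : nu y = (k%:~R)%:E.
  apply/eqP; rewrite eq_le; apply/andP; split.
    by apply: ereal_inf_lbound; exists k.
  apply/ereal_infP => _ [j /= nj <-]; rewrite lee_fin ler_int leNgt.
  by apply/negP => jk; apply: nj; apply/kP; rewrite lezD1.
rewrite nuE /= -mulrNz powR_intmul; last by rewrite ltW// (lt_trans ltr01 base_b_gt1).
by constructor.
Qed.

Lemma bexp_ge0 v : 0 <= bexp v.
Proof. by case: v => [r| |] //=; exact: powR_ge0. Qed.

Lemma bexp_le y k : Zlaurent B y ->
  bexp (nu y) <= base_b%:R ^ (- k) <-> level B k y.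
Proof.
have b0 : (0 : R) < base_b%:R by rewrite (lt_trans ltr01 base_b_gt1).
case/nuP => [h|j h]; first by split=> // _; rewrite exprz_ge0// ltW.
by rewrite ler_eXz2l ?base_b_gt1// lerN2 -h.
Qed.

Lemma bexp_eq0 y : Zlaurent B y ->
  bexp (nu y) = 0 <-> forall k, level B k y.
Proof.
have b0 : (base_b%:R : R) != 0 by rewrite gt_eqF// (lt_trans ltr01 base_b_gt1).
case/nuP => [h|j h]; first by split.
split=> [/eqP|/(_ (j + 1))/h]; first by rewrite expfz_eq0 (negbTE b0) andbF.
by rewrite gerDl ler10.
Qed.

Lemma nuN y : nu (- y) = nu y.
Proof.
rewrite /nu; congr (ereal_inf (image _ _)); apply/seteqP.
by split=> k /= nk hk; apply: nk; last rewrite -[y]opprK; exact: levelN.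
Qed.

Lemma bexp_ultra x y : Zlaurent B x -> Zlaurent B y ->
  bexp (nu (x + y)) <= Num.max (bexp (nu x)) (bexp (nu y)).
Proof.
move=> hx hy.
have hxy : Zlaurent B (x + y).
  rewrite -[y]opprK; apply: (ZlaurentB uB) => //.
  by rewrite -sub0r; apply: (ZlaurentB uB) => //; exact: (Zlaurent0 uB).
wlog xy : x y hx hy hxy / bexp (nu x) <= bexp (nu y).
  move=> hw; have [|/ltW] := leP (bexp (nu x)) (bexp (nu y)) => h.
    by have := hw _ _ hx hy hxy h; rewrite max_r.
  by rewrite addrC in hxy *; have := hw _ _ hy hx hxy h; rewrite max_r.
rewrite max_r//; case: (nuP hy) xy => [h|j h] xy.
  have /(bexp_eq0 hx) h' : bexp (nu x) = 0.
    by apply/eqP; rewrite eq_le xy bexp_ge0.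
  suff -> : bexp (nu (x + y)) = 0 by [].
  by apply/(bexp_eq0 hxy) => k; exact: levelD.
by apply/(bexp_le _ hxy)/levelD; [exact/(bexp_le _ hx)|exact/h].
Qed.

Lemma dBxx x : dB x x = 0.
Proof.
rewrite /dB subrr; apply/bexp_eq0; first exact: (Zlaurent0 uB).
by move=> k; exact: level0.
Qed.

Lemma dB_sym x y : dB x y = dB y x.
Proof. by rewrite /dB -opprB nuN. Qed.

Lemma dB_ge0 x y : 0 <= dB x y. Proof. exact: bexp_ge0. Qed.

Lemma dB_triangle y x z : Zlaurent B x -> Zlaurent B y -> Zlaurent B z ->
  dB x z <= dB x y + dB y z.
Proof.
move=> hx hy hz; rewrite /dB -(subrKA y x).
have := bexp_ultra (ZlaurentB uB hx hy) (ZlaurentB uB hy hz).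
move=> /le_trans; apply; rewrite ge_max.
by rewrite lerDl lerDr !bexp_ge0.
Qed.

Lemma dBD x y x' y' : Zlaurent B x -> Zlaurent B y -> Zlaurent B x' ->
  Zlaurent B y' -> dB (x - x') (y - y') <= dB x y + dB x' y'.
Proof.
move=> hx hy hx' hy'; rewrite /dB.
have -> : x - x' - (y - y') = (x - y) - (x' - y') by rewrite !opprB addrACA [RHS]addrACA [- x' - y]addrC.
have := bexp_ultra (ZlaurentB uB hx hy) (ZlaurentB uB hy' hx').
rewrite -[y' - x']opprB nuN => /le_trans; apply; rewrite ge_max.
by rewrite lerDl lerDr !bexp_ge0.
Qed.

Lemma dB_dist x y x' y' : Zlaurent B x -> Zlaurent B y -> Zlaurent B x' ->
  Zlaurent B y' -> `|dB x y - dB x' y'| <= dB x x' + dB y y'.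
Proof.
move=> hx hy hx' hy'.
rewrite ler_distl; apply/andP; split.
  rewrite lerBlDr; apply: le_trans (dB_triangle hx' hx hy') _.
  rewrite (dB_sym x') [leRHS]addrC -addrA lerD2l// [leRHS]addrC.
  exact: dB_triangle.
apply: le_trans (dB_triangle hx hx' hy) _.
rewrite [leRHS]addrCA lerD2l//.
by rewrite (dB_sym y); exact: dB_triangle.
Qed.

Lemma level_mulA k x :
  level B k (mxA A *m x) <-> level B (k + 1) x.
Proof.
have -> : mxA A = B ^ (-1) by rewrite exprN1 /B /mxB invrK.
by rewrite -[in X in X <-> _](addKr 1 k) [1 + k]addrC; exact: level_mulE.
Qed.

Lemma Zlaurent_mulA x : Zlaurent B x -> Zlaurent B (mxA A *m x).
Proof.
have -> : mxA A = B ^ (-1) by rewrite exprN1 /B /mxB invrK.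
exact: Zlaurent_mul.
Qed.

Lemma bexp_nu_mulA x : Zlaurent B x ->
  bexp (nu (mxA A *m x)) = base_b%:R * bexp (nu x).
Proof.
move=> hx.
have b0 : (base_b%:R : R) != 0 by rewrite gt_eqF// (lt_trans ltr01 base_b_gt1).
case: (nuP (Zlaurent_mulA hx)) => [hA|i hA]; case: (nuP hx) => [h|j h].
- by rewrite mulr0.
- have /h : level B (j + 1) x by apply/level_mulA; exact: hA.
  by rewrite gerDl ler10.
- have /hA : level B (i + 1) (mxA A *m x) by apply/level_mulA; exact: h.
  by rewrite gerDl ler10.
- have -> : i = j - 1.
    apply/eqP; rewrite eq_le; apply/andP; split.
      by rewrite lerBrDr; apply/h/level_mulA/hA.
    by apply/hA/level_mulA; rewrite subrK; exact/h.
  by rewrite opprB addrC expfzDr// expr1z mulrC.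
Qed.

End Valuation.

Section Completion.
Variables (R : realType) (n : nat) (A : base n).
Implicit Types u v : nat -> 'cV[rat]_n.+1.

Let uB : mxB A \is a GRing.unit := mxB_unit A.

Definition is_cauchy u : Prop :=
  (forall k, Zlaurent (mxB A) (u k)) /\
  (forall e : R, 0 < e -> exists N, forall k l, (N <= k)%N -> (N <= l)%N ->
    dB R A (u k) (u l) < e).

Definition cauchy_seqs : {pred nat -> 'cV[rat]_n.+1} :=
  fun u => `[< is_cauchy u >].

Lemma cauchy_seqsP u : reflect (is_cauchy u) (u \in cauchy_seqs).
Proof. exact: asboolP. Qed.

Lemma cauchy_zmod_closed : zmod_closed cauchy_seqs.
Proof.
split=> [|u v /cauchy_seqsP[hu cu] /cauchy_seqsP[hv cv]]; apply/cauchy_seqsP.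
  split=> [k|e e0]; first exact: (Zlaurent0 uB).
  by exists 0%N => k l _ _; rewrite dBxx.
split=> [k|e e0]; first exact: (ZlaurentB uB).
have e2 : 0 < e / 2 by rewrite divr_gt0.
have [N hN] := cu _ e2; have [N' hN'] := cv _ e2.
exists (maxn N N') => k l; rewrite !geq_max => /andP[Nk N'k] /andP[Nl N'l].
rewrite (splitr e); apply: le_lt_trans (ltrD (hN _ _ Nk Nl) (hN' _ _ N'k N'l)).
exact: dBD.
Qed.

HB.instance Definition _ := GRing.isZmodClosed.Build
  (nat -> 'cV[rat]_n.+1) cauchy_seqs cauchy_zmod_closed.

(* The completion is the group of Cauchy sequences of [Z^n(B)] modulo those at
   distance tending to 0 from 0. *)
Record cseq := CSeq { cval :> nat -> 'cV[rat]_n.+1 ; _ : cval \in cauchy_seqs }.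

HB.instance Definition _ := [isSub for cval].
HB.instance Definition _ := [Choice of cseq by <:].
HB.instance Definition _ := [SubChoice_isSubZmodule of cseq by <:].

Lemma cseqP (u : cseq) : is_cauchy u.
Proof. exact/cauchy_seqsP/(valP u). Qed.

Lemma cseq_laurent (u : cseq) k : Zlaurent (mxB A) (u k).
Proof. exact: (cseqP u).1. Qed.

Lemma cvg_dB (u v : cseq) : cvgn (fun k => dB R A (u k) (v k)).
Proof.
apply/cauchy_cvgP/cauchy_exP => e e0.
have e2 : 0 < e / 2 by rewrite divr_gt0.
have [N hN] := (cseqP u).2 _ e2; have [N' hN'] := (cseqP v).2 _ e2.
exists (dB R A (u (maxn N N')) (v (maxn N N'))).
exists (maxn N N') => // k /=; rewrite geq_max => /andP[Nk N'k].
rewrite /ball/= (splitr e).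
apply: le_lt_trans (ltrD (hN _ _ (leq_maxl _ _) Nk) (hN' _ _ (leq_maxr _ _) N'k)).
by apply: dB_dist; exact: cseq_laurent.
Qed.

Definition null_seqs : {pred cseq} :=
  fun u : cseq => `[< (fun k => dB R A (u k) 0) @ \oo --> (0 : R) >].

Lemma null_seqsP (u : cseq) :
  reflect ((fun k => dB R A (u k) 0) @ \oo --> (0 : R)) (u \in null_seqs).
Proof. exact: asboolP. Qed.

Lemma null_zmod_closed : zmod_closed null_seqs.
Proof.
split=> [|u v /null_seqsP hu /null_seqsP hv]; apply/null_seqsP.
  by under eq_fun do rewrite dBxx; exact: cvg_cst.
have := @cvgD _ _ _ _ eventually_filter _ _ _ _ hu hv; rewrite addr0 => h.
apply: (squeeze_cvgr (f := cst 0) _ (cvg_cst 0) h).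
near=> k; rewrite dB_ge0/= -[X in dB R A _ X](subr0 0).
by apply: dBD; try exact: cseq_laurent; exact: (Zlaurent0 uB).
Unshelve. all: by end_near. Qed.

HB.instance Definition _ := GRing.isZmodClosed.Build
  cseq null_seqs null_zmod_closed.

Definition Zcompl := Quotient.quot null_seqs.

HB.instance Definition _ := GRing.Zmodule.on Zcompl.
HB.instance Definition _ := Quotient.on Zcompl.
HB.instance Definition _ := isPointed.Build Zcompl 0.

Definition Zclass (u : cseq) : Zcompl := (\pi_(Quotient.quot null_seqs) u)%qT.

Definition Zcompl_dist (p q : Zcompl) : R :=
  limn (fun k => dB R A ((repr p : cseq) k) ((repr q : cseq) k)).

Lemma Zclass_eq (u v : cseq) :
  (fun k => dB R A (u k) (v k)) @ \oo --> (0 : R) <-> Zclass u = Zclass v.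
Proof.
have E : (u - v \in null_seqs) = (Zclass u == Zclass v).
  by rewrite Quotient.idealrBE.
have E2 : (fun k => dB R A ((u - v) k) 0) = (fun k => dB R A (u k) (v k)).
  by apply/funext => k; rewrite /dB subr0.
by split=> [h|/eqP]; [apply/eqP; rewrite -E; apply/null_seqsP; rewrite E2|
  rewrite -E => /null_seqsP; rewrite E2].
Qed.

Lemma Zclass_repr (p : Zcompl) : Zclass (repr p) = p.
Proof. exact: reprK. Qed.

Lemma dist_Zclass (u v : cseq) :
  Zcompl_dist (Zclass u) (Zclass v) = limn (fun k => dB R A (u k) (v k)).
Proof.
set u' := repr (Zclass u); set v' := repr (Zclass v).
have hu : (fun k => dB R A (u' k) (u k)) @ \oo --> (0 : R).
  by apply/Zclass_eq; exact: Zclass_repr.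
have hv : (fun k => dB R A (v' k) (v k)) @ \oo --> (0 : R).
  by apply/Zclass_eq; exact: Zclass_repr.
have := @cvgD _ _ _ _ eventually_filter _ _ _ _ hu hv; rewrite addr0 => h.
have hd : (fun k => dB R A (u' k) (v' k) - dB R A (u k) (v k)) @ \oo --> (0 : R).
  apply: norm_cvg0; apply: (squeeze_cvgr (f := cst 0) _ (cvg_cst 0) h).
  near=> k; rewrite normr_ge0/=.
  by apply: dB_dist; exact: cseq_laurent.
have := @cvgD _ _ _ _ eventually_filter _ _ _ _ hd (@cvg_dB u v); rewrite add0r => h2.
apply/cvg_lim => //.
rewrite (_ : (fun k => _) = (fun k => dB R A (u' k) (v' k) - dB R A (u k) (v k)) + (fun k => dB R A (u k) (v k))) //.
by apply/funext => k /=; rewrite !fctE subrK.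
Unshelve. all: by end_near. Qed.

Lemma Zcompl_distxx p : Zcompl_dist p p = 0.
Proof. by rewrite /Zcompl_dist; under eq_fun do rewrite dBxx; rewrite lim_cst. Qed.

Lemma Zcompl_dist_positivity p q : Zcompl_dist p q = 0 -> p = q.
Proof.
move=> h; rewrite -(Zclass_repr p) -(Zclass_repr q); apply/Zclass_eq.
by rewrite -h; exact: cvg_dB.
Qed.

Lemma Zcompl_dist_sym p q : Zcompl_dist p q = Zcompl_dist q p.
Proof. by rewrite /Zcompl_dist; under eq_fun do rewrite dB_sym. Qed.

Lemma Zcompl_dist_triangle q p r :
  Zcompl_dist p r <= Zcompl_dist p q + Zcompl_dist q r.
Proof.
rewrite /Zcompl_dist -limD; [|exact: cvg_dB..].
apply: ler_lim; [exact: cvg_dB|by apply: is_cvgD; exact: cvg_dB|].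
by near=> k; apply: dB_triangle; exact: cseq_laurent.
Unshelve. all: by end_near. Qed.

HB.instance Definition _ := isMetric.Build R Zcompl
  Zcompl_distxx Zcompl_dist_positivity Zcompl_dist_sym Zcompl_dist_triangle.

Lemma cauchy_cst x : Zlaurent (mxB A) x -> (fun=> x) \in cauchy_seqs.
Proof.
by move=> hx; apply/cauchy_seqsP; split=> // e e0; exists 0%N => k l; rewrite dBxx.
Qed.

(* The canonical map [Z^n(B) -> Z^n((B))], extended by 0 outside [Z^n(B)] *)
Definition Zemb (x : 'cV[rat]_n.+1) : Zcompl := Zclass (insubd (0 : cseq) (fun=> x)).

Lemma insub_cst x : Zlaurent (mxB A) x ->
  cval (insubd (0 : cseq) (fun=> x)) = fun=> x.
Proof. by move=> hx; rewrite insubdK//; exact: cauchy_cst. Qed.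

Lemma dist_Zemb x y : Zlaurent (mxB A) x -> Zlaurent (mxB A) y ->
  mdist (Zemb x) (Zemb y) = dB R A x y.
Proof.
move=> hx hy; rewrite -[LHS]/(Zcompl_dist _ _) dist_Zclass.
by rewrite !insub_cst// lim_cst.
Qed.

Lemma cauchy_mulA u : u \in cauchy_seqs ->
  (fun k => mxA A *m u k) \in cauchy_seqs.
Proof.
move=> /cauchy_seqsP[hu cu]; apply/cauchy_seqsP; split=> [k|e e0].
  exact: Zlaurent_mulA.
have b0 : 0 < ((base_b A)%:R : R) by rewrite (lt_trans ltr01 (base_b_gt1 R A)).
have [N hN] := cu _ (divr_gt0 e0 b0); exists N => k l Nk Nl.
rewrite /dB -mulmxBr bexp_nu_mulA; last exact: (ZlaurentB uB).
by rewrite mulrC -ltr_pdivlMr//; exact: hN.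
Qed.

Definition cseq_mulA (u : cseq) : cseq := CSeq (cauchy_mulA (valP u)).

Definition Zcompl_mulA (p : Zcompl) : Zcompl := Zclass (cseq_mulA (repr p)).

Lemma Zcompl_mulA_class (u : cseq) :
  Zcompl_mulA (Zclass u) = Zclass (cseq_mulA u).
Proof.
apply/Zclass_eq.
have h : (fun k => dB R A ((repr (Zclass u) : cseq) k) (u k)) @ \oo --> (0 : R).
  by apply/Zclass_eq; exact: Zclass_repr.
rewrite -(mulr0 ((base_b A)%:R : R)).
rewrite (_ : (fun k => _) = (fun k => (base_b A)%:R *
    dB R A ((repr (Zclass u) : cseq) k) (u k))); first exact: cvgMl_tmp.
apply/funext => k; rewrite /dB /= -mulmxBr bexp_nu_mulA//.
by apply: (ZlaurentB uB); exact: cseq_laurent.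
Qed.

Lemma Zcompl_mulA_emb x : Zlaurent (mxB A) x ->
  Zcompl_mulA (Zemb x) = Zemb (mxA A *m x).
Proof.
move=> hx; rewrite Zcompl_mulA_class; congr Zclass; apply/val_inj => /=.
rewrite (insub_cst (Zlaurent_mulA hx)).
by apply/funext => k; rewrite (insub_cst hx).
Qed.

(* Independent of the representative ([Zcompl_nu_class]), extends [nu]
   ([Zcompl_nu_emb]), and satisfies [dB y 0 = b ^ (- nu y)]
   ([Zcompl_nu_dist]). *)
Definition Zcompl_nu (p : Zcompl) : \bar R :=
  limn (fun k => nu R A ((repr p : cseq) k)).

Definition Zintegral : set Zcompl := [set p | (0 <= Zcompl_nu p)%E].

Lemma cvg_nu (u : cseq) :
  [/\ limn (fun k => nu R A (u k)) = +oo%E,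
      nu R A (u k) @[k --> \oo] --> +oo%E & mdist (Zclass u) 0 = 0] \/
  exists j : int, [/\ limn (fun k => nu R A (u k)) = (j%:~R)%:E,
      nu R A (u k) @[k --> \oo] --> (j%:~R)%:E &
      mdist (Zclass u) 0 = (base_b A)%:R ^ (- j)].
Proof.
have b1 := base_b_gt1 R A; have b0 := lt_trans ltr01 b1.
have E0 : Zclass 0 = 0 by exact: (raddf0 (\pi_(Quotient.quot null_seqs))%qT).
have distE : mdist (Zclass u) 0 = limn (fun k => dB R A (u k) 0).
  by rewrite -E0 -[LHS]/(Zcompl_dist _ _) dist_Zclass.
have cu : (fun k => dB R A (u k) 0) @ \oo --> mdist (Zclass u) 0.
  by rewrite distE; exact: (@cvg_dB u 0).
have [L0|L0] := eqVneq (mdist (Zclass u) 0) 0; [left|right].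
  have c : nu R A (u k) @[k --> \oo] --> +oo%E.
    apply/cvgeyPge => M.
    pose K : int := Num.ceil M.
    have bK : (0 : R) < (base_b A)%:R ^ (- K) by rewrite exprz_gt0.
    rewrite L0 in cu; near=> k.
    have : dB R A (u k) 0 <= (base_b A)%:R ^ (- K).
      by near: k; exact: (cvgr_le _ cu).
    rewrite /dB subr0 => /bexp_le-/(_ (cseq_laurent _ _)) lK.
    case: (nuP R (cseq_laurent u k)) => [_|j /(_ K)/iffLR/(_ lK) Kj].
      by rewrite leey.
    rewrite lee_fin; apply: le_trans (Num.Theory.ceil_ge _) _.
    by rewrite ler_int.
  by split => //; apply/cvg_lim.
have Lpos : 0 < mdist (Zclass u) 0 by rewrite lt_neqAle eq_sym L0 mdist_ge0.
have L2 : 0 < mdist (Zclass u) 0 / 2 by rewrite divr_gt0.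
have [N hN] := (cseqP u).2 _ L2.
have [N' _ hN'] : \forall k \near \oo, mdist (Zclass u) 0 / 2 < dB R A (u k) 0.
  by apply: (cvgr_gt _ cu); rewrite ltr_pdivrMr// ltr_pMr// ltr1n.
pose m := maxn N N'.
have hm : mdist (Zclass u) 0 / 2 < bexp A (nu R A (u m)).
  by have := hN' m (leq_maxr _ _); rewrite /= /dB subr0.
have [j hj] : exists j, forall i, level (mxB A) i (u m) <-> i <= j.
  case: (nuP R (cseq_laurent u m)) hm => [_|j hj _]; last by exists j.
  by rewrite ltNge ltW.
exists j.
have stab k : (m <= k)%N -> forall i, level (mxB A) i (u k) <-> i <= j.
  move=> mk; have w : level (mxB A) (j + 1) (u k - u m).
    have := hN k m (leq_trans (leq_maxl _ _) mk) (leq_maxl _ _).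
    rewrite /dB => /lt_trans/(_ hm).
    case: (nuP R (ZlaurentB uB (cseq_laurent u k) (cseq_laurent u m))) => [h _|i hi].
      exact: h.
    case: (nuP R (cseq_laurent u m)) => [/(_ (j + 1))/hj|i' hi'].
      by rewrite gerDl ler10.
    have -> : i' = j.
      by apply/eqP; rewrite eq_le; apply/andP; split; [apply/hj/hi'|apply/hi'/hj].
    rewrite ltNge => /negP h; apply/hi; rewrite leNgt; apply/negP => ij; apply: h.
    by rewrite ler_eXz2l// lerN2 -ltzD1.
  move=> i; split=> [li|ij].
    rewrite leNgt; apply/negP => ji.
    suff /hj : level (mxB A) (j + 1) (u m) by rewrite gerDl ler10.
    rewrite -(subKr (u k) (u m)); apply: levelB => //.
    by apply: (level_le uB) li; rewrite lezD1.
  rewrite -(subrK (u m) (u k)); apply: levelD; last exact/hj.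
  by apply: (level_le uB) w; rewrite ler_wpDr.
have nuj k : (m <= k)%N -> nu R A (u k) = (j%:~R)%:E /\
    bexp A (nu R A (u k)) = (base_b A)%:R ^ (- j).
  move=> mk; case: (nuP R (cseq_laurent u k)) => [/(_ (j + 1))/(stab _ mk)|i hi].
    by rewrite gerDl ler10.
  suff -> : i = j by [].
  apply/eqP; rewrite eq_le; apply/andP; split.
    exact/(stab _ mk)/hi.
  exact/hi/(stab _ mk).
have c : nu R A (u k) @[k --> \oo] --> (j%:~R)%:E.
  by apply: cvg_near_cst; exists m => // k /= /nuj[].
split => //; first exact/cvg_lim.
rewrite distE; apply/cvg_lim => //; apply: cvg_near_cst.
by exists m => // k /= /nuj[_ <-]; rewrite /dB subr0.
Unshelve. all: by end_near. Qed.

Lemma Zcompl_nu_class (u : cseq) :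
  Zcompl_nu (Zclass u) = limn (fun k => nu R A (u k)).
Proof.
have b1 := base_b_gt1 R A; have b0 := lt_trans ltr01 b1.
rewrite /Zcompl_nu; have := cvg_nu (repr (Zclass u)); rewrite Zclass_repr.
move=> [[-> _ d]|[j [-> _ d]]]; have [[-> _ e]|[i [-> _ e]]] := cvg_nu u => //.
- by have := exprz_gt0 (- i) b0; rewrite -e d ltxx.
- by have := exprz_gt0 (- j) b0; rewrite -d e ltxx.
congr ((_%:~R)%:E); apply: oppr_inj; move: d; rewrite e.
by move=> /esym; apply: ieexprIz => //; rewrite gt_eqF.
Qed.

Lemma Zcompl_nu_emb x : Zlaurent (mxB A) x -> Zcompl_nu (Zemb x) = nu R A x.
Proof. by move=> hx; rewrite Zcompl_nu_class insub_cst// lim_cst. Qed.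

Lemma Zcompl_nu_dist (p : Zcompl) : bexp A (Zcompl_nu p) = mdist p 0.
Proof.
have b1 := base_b_gt1 R A; have b0 := lt_trans ltr01 b1.
rewrite -[p]Zclass_repr Zcompl_nu_class.
have [[-> _ ->]|[i [-> _ ->]]] //= := cvg_nu (repr p).
by rewrite -mulrNz powR_intmul// ltW.
Qed.

End Completion.

Notation borel T := (g_sigma_algebraType (@open T)).

Section RepresentationSpace.
Variables (R : realType) (n : nat) (A : base n).

(* The library's product structure uses the sup norm on the first factor; it
   has the same topology as the metric [KA_dist]. *)
Definition KA : Type := ('cV[R]_n.+1 * Zcompl R A)%type.

HB.instance Definition _ := GRing.Zmodule.on KA.
HB.instance Definition _ := PseudoMetric.on KA.

Definition enorm (x : 'cV[R]_n.+1) : R := Num.sqrt (\sum_i x i 0 ^+ 2).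

Definition KA_dist (p q : KA) : R :=
  Num.max (enorm (p.1 - q.1)) (mdist p.2 q.2).

Definition phi (x : 'cV[rat]_n.+1) : KA := (map_mx ratr x, Zemb R A x).

Definition KA_mulA (p : KA) : KA :=
  (map_mx ratr (mxA A) *m p.1, Zcompl_mulA p.2).

Definition uniformly_discrete (M : set KA) : Prop :=
  exists2 r : R, 0 < r & forall c p q : KA, M p -> M q ->
    KA_dist c p < r -> KA_dist c q < r -> p = q.

(* These values characterize Lebesgue measure among Borel measures. *)
Definition is_lebesgue (lam : {measure set (borel 'cV[R]_n.+1) -> \bar R}) : Prop :=
  forall a b : 'cV[R]_n.+1, (forall i, a i 0 <= b i 0) ->
  lam [set x : 'cV[R]_n.+1 | forall i, a i 0 <= x i 0 <= b i 0] =
  (\prod_i (b i 0 - a i 0))%:E.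

(* Regularity is automatic here: [Z^n((B))] is a sigma-compact, locally compact
   metric group. *)
Definition is_haar (mu : {measure set (borel (Zcompl R A)) -> \bar R}) : Prop :=
  [/\ forall (S : set (borel (Zcompl R A))) (y : Zcompl R A), measurable S ->
        mu [set y + s | s in (S : set (Zcompl R A))] = mu S,
      forall K : set (Zcompl R A), compact K -> (mu K < +oo)%E &
      mu setT != 0%E].

(* By contractivity of [A^-1], exactly one set [F] satisfies this. *)
Definition digit_tile (D : {fset 'cV[rat]_n.+1}) (F : set KA) : Prop :=
  [/\ F !=set0, compact F &
      KA_mulA @` F = \bigcup_(d in [set` D]) [set p + phi d | p in F]].

End RepresentationSpace.

Section Digits.
Variables (n : nat) (A : 'M[rat]_n.+1) (D : {fset 'cV[rat]_n.+1}).

Definition digit_system : Prop :=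
  [/\ expanding A, [set` D] `<=` Zpoly A & #|` D| = quot_card A].

Definition expansion k (d : {ffun 'I_k -> D}) : 'cV[rat]_n.+1 :=
  \sum_(i < k) (A ^+ i) *m val (d i).

Definition Dk k : set 'cV[rat]_n.+1 := range (@expansion k).

Definition Dinf : set 'cV[rat]_n.+1 := \bigcup_(k in [set k | (1 <= k)%N]) Dk k.

End Digits.

Lemma digit_system_expanding n (A : 'M[rat]_n.+1) (D : {fset 'cV[rat]_n.+1}) :
  digit_system A D -> expanding A.
Proof. by case. Qed.

Definition digit_base n (A : 'M[rat]_n.+1) (D : {fset 'cV[rat]_n.+1})
  (hD : digit_system A D) (hb : (2 <= quot_card A^-1)%N) : base n :=
  Base (digit_system_expanding hD) hb.

(* Main.v *)
(* Let [G] be the image of [Z^n[A]] in [K_A]. It is a lattice: [Z^n[A]] meets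
   [Z^n[A^-1]] in a subgroup of [1/N Z^n], and every point of [K_A] is within a
   bounded distance of [G]. Hence [phi (D_oo)], a subset of [G], is always
   uniformly discrete, and only the distinctness of the expansions matters.
   As [A^k G] has index [a^k] in [G], counting the translates of a small set [U]
   by [A^-k G] that meet a bounded region gives
   [c a^-k <= mu (A^-k U) <= C a^-k], without computing how [A] scales [mu].
   Since [F] is the union of the [A^-k (F + phi t)] over [t] in [D_k], a single
   coincidence among expansions of length [k] gives
   [mu F <= C ((a^k - 1) / a^k)^m] for all [m], so [mu F = 0]. Conversely, if the
   expansions are distinct, the [a^k] sets [A^-k (U + phi t)] are disjoint, have
   total measure at least [c], and accumulate on the closed set [F]. *)

Require Import Defs.
From HB Require Import structures.
From mathcomp Require Import all_boot all_order all_algebra all_field.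
From mathcomp Require Import finmap ring lra.
From mathcomp Require Import all_classical all_reals all_analysis.
Import Order.TTheory GRing.Theory Num.Theory.
Import numFieldNormedType.Exports.
Local Open Scope classical_set_scope.
Local Open Scope ring_scope.

Set Implicit Arguments.
Unset Strict Implicit.
Unset Printing Implicit Defensive.

(** * The lattice [Z^n[A]] and its intersection with [Z^n[A^-1]] *)

(** Digits of [D] may be congruent modulo [A], so they cannot label cosets: cosets are counted with
    an auxiliary residue system [r], while [D] contributes [a ^ k] words. The two counts ask for
    different cubes. Disjointness of translates needs a side [d] below the separation of the
    lattice, whereas covering is done with the unit cube; [tile_refine] passes from one to the other
    at a cost independent of [k]. Both counts rely on [Z^n] lying in [Z^n[A]] and in [Z^n[A^-1]]: a
    real coordinate can be rounded to an integer without disturbing integrality in the second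
    factor. No adapted norm is used on the real factor; entrywise bounds on [A^-k] suffice, since
    constants independent of [k] are harmless. Finally [F] is exhibited as an upper limit of finite
    unions of rectangles. This form makes it measurable for the product of the two Borel algebras,
    and it turns a lower bound for each finite level into one for [F] by the reverse Fatou
    inequality. *)

Section LatticeAlgebra.
Variable n : nat.
Implicit Types (M : 'M[rat]_n.+1) (x y : 'cV[rat]_n.+1) (z w : 'cV[int]_n.+1).

Lemma zvec0 : @zvec n 0 = 0. Proof. by rewrite /zvec map_mx0. Qed.

Lemma zvecB z w : zvec (z - w) = zvec z - zvec w.
Proof. by rewrite /zvec map_mxB. Qed.

Lemma zvecD z w : zvec (z + w) = zvec z + zvec w.
Proof. by rewrite /zvec map_mxD. Qed.

Lemma zvecZ (a : int) z : zvec (a *: z) = a%:~R *: zvec z.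
Proof. by rewrite /zvec map_mxZ. Qed.

Lemma ZspanD M m x y : Zspan M m x -> Zspan M m y -> Zspan M m (x + y).
Proof.
move=> hx hy; rewrite -[y]opprK; apply: ZspanB => //.
by rewrite -sub0r; apply: ZspanB => //; exact: Zspan0.
Qed.

Lemma ZspanS M m x :
  Zspan M m.+1 x <-> exists z y, Zspan M m y /\ x = zvec z + M *m y.
Proof.
split=> [[z _ <-]|[z [y [hy ->]]]].
  exists (z 0%N), (\sum_(i < m) M ^+ i *m zvec (z i.+1)).
  split; first by exists (z \o succn).
  rewrite big_ord_recl expr0 mul1mx mulmx_sumr /=; congr (_ + _).
  by apply: eq_bigr => i _; rewrite mulmxA exprS.
apply: ZspanD; last exact: Zspan_mul.
exists (fun i => if i == 0%N then z else 0) => //.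
rewrite big_ord_recl/= expr0 mul1mx big1 ?addr0// => i _.
by rewrite zvec0 mulmx0.
Qed.

Lemma ZspanSr M m x :
  Zspan M m.+1 x -> exists z y, Zspan M m y /\ x = y + M ^+ m *m zvec z.
Proof.
move=> [z _ <-]; exists (z m), (\sum_(i < m) M ^+ i *m zvec (z i)).
by rewrite big_ord_recr; split => //; exists z.
Qed.

Lemma Zspan_exp M m k x : Zspan M m x -> Zspan M (k + m) (M ^+ k *m x).
Proof.
move=> mx; elim: k => [|k ih]; first by rewrite expr0 mul1mx.
by rewrite exprS -mulmxE -mulmxA addSn; exact: Zspan_mul.
Qed.

Lemma Zpoly_zvec M z : Zpoly M (zvec z).
Proof.
apply/ZpolyP; exists 1%N; apply/ZspanS; exists z, 0.
by split; [exact: Zspan0|rewrite mulmx0 addr0].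
Qed.

Lemma ZpolyN M x : Zpoly M x -> Zpoly M (- x).
Proof. by move=> hx; rewrite -sub0r; apply: ZpolyB => //; exact: Zpoly0. Qed.

Lemma ZpolyD M x y : Zpoly M x -> Zpoly M y -> Zpoly M (x + y).
Proof. by move=> hx hy; rewrite -[y]opprK; apply: ZpolyB => //; exact: ZpolyN. Qed.

Lemma Zpoly_exp M k x : Zpoly M x -> Zpoly M (M ^+ k *m x).
Proof. by move=> /ZpolyP[m mx]; apply/ZpolyP; exists (k + m)%N; exact: Zspan_exp. Qed.

Lemma Zpoly_sum M I (r : seq I) (P : pred I) (F : I -> 'cV[rat]_n.+1) :
  (forall i, P i -> Zpoly M (F i)) -> Zpoly M (\sum_(i <- r | P i) F i).
Proof. by move=> h; apply: big_ind => //; [exact: Zpoly0|move=> x y; exact: ZpolyD]. Qed.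

Lemma Zpoly_split M x :
  Zpoly M x -> exists z y, Zpoly M y /\ x = zvec z + M *m y.
Proof.
move=> /ZpolyP[m mx]; have /ZspanS[z [y [hy ->]]] := Zspan_le (leqnSn m) mx.
by exists z, y; split => //; apply/ZpolyP; exists m.
Qed.

Lemma denom_mx M : exists2 N : nat, (0 < N)%N &
  forall z, exists w, N%:R *: (M *m zvec z) = zvec w.
Proof.
pose N := (\prod_(p : 'I_n.+1 * 'I_n.+1) `|denq (M p.1 p.2)|)%N.
have N0 : (0 < N)%N by apply: prodn_gt0 => p; rewrite absz_gt0 denq_neq0.
exists N => // z.
have h i j : N%:R * M i j \is a Num.int.
  rewrite /N (bigD1 (i, j))//= natrM mulrAC.
  rewrite -[X in X * M i j * _](_ : (denq (M i j))%:~R = _); last first.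
    by rewrite pmulrn gtz0_abs// denq_gt0.
  by rewrite [_ * M i j]mulrC -numqE rpredM// ?intr_int// intr_nat.
exists (\col_i Num.floor ((N%:R *: (M *m zvec z)) i 0)).
apply/matrixP => i j; rewrite [RHS]mxE mxE ord1 floorK//.
rewrite mxE mxE mulr_sumr; apply: rpred_sum => k _.
by rewrite mulrA mxE rpredM// intr_int.
Qed.

Lemma Zspan_denom M m : exists2 N : nat, (0 < N)%N &
  forall x, Zspan M m x -> exists w, N%:R *: x = zvec w.
Proof.
elim: m => [|m [N N0 hN]].
  by exists 1%N => // x [z _ <-]; exists 0; rewrite big_ord0 scaler0 zvec0.
have [N' N'0 hN'] := denom_mx M.
exists (N' * N)%N => [|x /ZspanS[z [y [/hN[w hw] ->]]]]; first by rewrite muln_gt0 N'0.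
have [w' hw'] := hN' w.
exists ((N' * N)%N%:Z *: z + w').
by rewrite zvecD zvecZ -hw' -hw scalerDr -scalemxAr scalerA -natrM.
Qed.

End LatticeAlgebra.

(** An index of maximal cardinality works: every later set contains that one and is no larger. *)
Lemma increasing_sets_stationary (T : finType) (S : nat -> {set T}) :
  (forall k, S k \subset S k.+1) ->
  exists K, forall k, (K <= k)%N -> S k = S K.
Proof.
move=> mono.
have mono' j k : (j <= k)%N -> S j \subset S k.
  elim: k => [|k ih]; first by rewrite leqn0 => /eqP->.
  rewrite leq_eqVlt => /predU1P[->//|/ih jk].
  exact: fintype.subset_trans jk (mono k).
have ex : exists c, `[< exists k, #|S k| = c >] by exists #|S 0%N|; apply/asboolP; exists 0%N.
have ub c : `[< exists k, #|S k| = c >] -> (c <= #|T|)%N.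
  by move=> /asboolP[k <-]; exact: max_card.
case: (ex_maxnP ex ub) => _ /asboolP[K <-] maxK; exists K => k Kk.
apply/esym/eqP; rewrite eqEcard mono'//=; apply: maxK.
by apply/asboolP; exists k.
Qed.

Section LatticeIntersection.
Variable n : nat.
Variable M : 'M[rat]_n.+1.
Hypothesis uM : M \is a GRing.unit.
Implicit Types (x y : 'cV[rat]_n.+1) (z w : 'cV[int]_n.+1).

(** The coefficients [z] whose term of degree [k] can be rewritten with terms of lower degree. *)
Let H k z := Zspan M k (M ^+ k *m zvec z).

(* The subgroups [H k] of [Z^n] increase with [k] and contain a common [N Z^n]. *)
Lemma leading_stationary : exists K, forall k z, (K <= k)%N -> H k z <-> H K z.
Proof.
have HS k z : H k z -> H k.+1 z.
  by move=> h; rewrite /H exprS -mulmxE -mulmxA; exact: Zspan_mul.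
have HD k z w : H k z -> H k w -> H k (z + w).
  by move=> h h'; rewrite /H zvecD mulmxDr; exact: ZspanD.
have HB k z w : H k z -> H k w -> H k (z - w).
  by move=> h h'; rewrite /H zvecB mulmxBr; exact: ZspanB.
have [N N0 hN] := denom_mx M.
have HN k w : H k.+1 (N%:Z *: w).
  have [w' hw'] := hN w.
  rewrite /H zvecZ exprSr -mulmxE -mulmxA -scalemxAr hw'.
  rewrite -[X in Zspan _ X](addn1 k); apply: Zspan_exp; apply/ZspanS; exists w', 0.
  by split; [exact: Zspan0|rewrite mulmx0 addr0].
have Nz : N%:Z != 0 by rewrite eqz_nat -lt0n.
case: N N0 hN HN Nz => // N _ _ HN Nz.
pose lift (r : 'cV['I_N.+1]_n.+1) : 'cV[int]_n.+1 := map_mx (fun i : 'I_N.+1 => i%:Z) r.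
(* The index is shifted by one because [H 0] contains only 0; from degree one on, [HN] makes
   membership depend on residues only. *)
pose S k : {set 'cV['I_N.+1]_n.+1} := finset (fun r => `[< H k.+1 (lift r) >]).
have inS k r : r \in S k <-> H k.+1 (lift r).
  by rewrite finset.in_set; split=> /asboolP.
have [K hK] : exists K, forall k, (K <= k)%N -> S k = S K.
  apply: increasing_sets_stationary => k; apply/fintype.subsetP => r.
  by move=> /inS h; apply/inS; exact: HS.
pose red z : 'cV['I_N.+1]_n.+1 := \col_i inord `|modz (z i ord0) N.+1|%N.
have redE z : exists w, z = lift (red z) + N.+1%:Z *: w.
  exists (\col_i divz (z i ord0) N.+1); apply/matrixP => i j.
  rewrite !mxE ord1 inordK; last first.
    by rewrite -ltz_nat abszE ger0_norm ?modz_ge0// ltz_pmod.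
  by rewrite abszE ger0_norm ?modz_ge0// mulrC addrC -divz_eq.
have redP k z : H k.+1 z <-> red z \in S k.
  have [w zE] := redE z; rewrite inS; split=> h.
    rewrite -[lift _](addrK (N.+1%:Z *: w)) -zE.
    exact: (HB _ _ _ h (HN k w)).
  by rewrite zE; exact: (HD _ _ _ h (HN k w)).
exists K.+1 => -[//|k] z Kk; rewrite !redP hK//.
Qed.

(** An expansion of [x] in negative powers makes [M ^+ m *m x] a span of length [m + 1]. If [x] also
    has an expansion with top term of large degree [k], multiplying by [M ^+ m] shows that its
    coefficient satisfies [H (m + k)]. By stationarity it satisfies [H k], so the top term can be
    absorbed into lower ones. *)
Lemma Zpoly_inter_span :
  exists K, forall x, Zpoly M x -> Zpoly M^-1 x -> Zspan M K x.
Proof.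
have [K hK] := leading_stationary; exists K.+1 => x /ZpolyP[k kx] xB.
have [m hm] : exists m, Zspan M m.+1 (M ^+ m *m x).
  case/ZpolyP: xB => -[|m]; move=> [z _ <-].
    by exists 0%N; rewrite big_ord0 mulmx0; exact: Zspan0.
  exists m; exists (fun i => z (m - i)%N) => //.
  rewrite mulmx_sumr [RHS](reindex_inj rev_ord_inj)/=; apply: eq_bigr => i _.
  rewrite subSS mulmxA mulmxE exprVn; congr (_ *m zvec (z _)).
    have im : (i <= m)%N by rewrite -ltnS.
    rewrite -{2}(subnK (leq_subr i m)) subKn// exprD.
    rewrite -mulrA divrr ?mulr1//; exact: unitrX.
have [|/ltnW Kk] := leqP k K.+1; first by move=> kK; exact: Zspan_le kx.
rewrite -(subnKC Kk) in kx; elim: (k - K.+1)%N kx => [|j ih]; first by rewrite addn0.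
rewrite addnS => /ZspanSr[z [y [hy xE]]]; apply: ih.
rewrite xE; apply: ZspanD => //.
have : H (m + (K.+1 + j)) z.
  rewrite /H; have -> : M ^+ (m + (K.+1 + j)) *m zvec z = M ^+ m *m x - M ^+ m *m y.
    by rewrite xE mulmxDr addrAC subrr add0r exprD mulmxA mulmxE.
  apply: ZspanB; last exact: Zspan_exp.
  by apply: Zspan_le hm; rewrite addSn addnS ltnS leq_addr.
have hle : (K <= K.+1 + j)%N by rewrite addSn ltnW// ltnS leq_addr.
by move=> /(hK _ _ (leq_trans hle (leq_addl m _))) /(hK _ _ hle).
Qed.

Lemma Zpoly_inter_denom : exists2 N : nat, (0 < N)%N &
  forall x, Zpoly M x -> Zpoly M^-1 x -> exists w, N%:R *: x = zvec w.
Proof.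
have [K hK] := Zpoly_inter_span; have [N N0 hN] := Zspan_denom M K.
by exists N => // x hx hx'; exact/hN/hK.
Qed.

Lemma Zlaurent_Zpoly x : Zpoly M x -> Zlaurent M x.
Proof. by move=> hx; apply/ZlaurentP => //; exists 0; exists x => //; rewrite expr0z mul1mx. Qed.

Lemma ZlaurentD x y : Zlaurent M x -> Zlaurent M y -> Zlaurent M (x + y).
Proof.
move=> hx hy; rewrite -[y]opprK; apply: ZlaurentB => //.
by rewrite -sub0r; apply: ZlaurentB => //; exact: Zlaurent0.
Qed.

Lemma Zlaurent_ZpolyV x : Zpoly M^-1 x -> Zlaurent M x.
Proof.
move=> /ZpolyP[m]; elim: m x => [|m ih] x.
  by move=> [z _ <-]; rewrite big_ord0; exact: Zlaurent0.
move=> /ZspanS[z [y [/ih hy ->]]]; apply: ZlaurentD.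
  exact/Zlaurent_Zpoly/Zpoly_zvec.
by rewrite -exprN1; exact: Zlaurent_mul.
Qed.

Lemma level0E x : level M 0 x <-> Zpoly M x.
Proof.
split=> [[y hy <-]|hx]; first by rewrite expr0z mul1mx.
by exists x => //; rewrite expr0z mul1mx.
Qed.

(** Split off the constant term of the polynomial: the negative power sends it into [Z^n[M^-1]], and
    the remainder carries one negative power less. *)
Lemma Zlaurent_decomp x : Zlaurent M x ->
  exists g y, [/\ Zpoly M^-1 g, Zpoly M y & x = g + y].
Proof.
move=> /(ZlaurentP uM)[k hk].
have {hk} [y hy <-] : level M (- `|k|%N%:Z) x.
  by apply: (level_le uM) hk; rewrite lerNl; have := ler_norm (- k); rewrite normrN.
elim: `|k|%N y hy => [|{}k ih] y hy.
  by exists 0, y; split => //; [exact: Zpoly0|rewrite oppr0 expr0z mul1mx add0r].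
have [z [y' [hy' ->]]] := Zpoly_split hy; have [g [h [hg hh E]]] := ih _ hy'.
exists (M^-1 ^+ k.+1 *m zvec z + g), h; split => //.
  by apply: ZpolyD => //; apply: Zpoly_exp; exact: Zpoly_zvec.
rewrite -addrA -E mulmxDr mulmxA mulmxE -exprnN -[in RHS]exprnN -!exprVn.
by congr (_ + _ *m _); rewrite exprSr -mulrA mulVr// mulr1.
Qed.

End LatticeIntersection.

(** * Powers of the inverse of an expanding matrix *)

Lemma geometric_recurrence (K : numFieldType) (w e : nat -> K) (l t C : K) :
  `|l| < t -> (forall k, `|e k| <= C * t ^+ k) ->
  (forall k, w k.+1 = l * w k + e k) ->
  exists C', forall k, `|w k| <= C' * t ^+ k.
Proof.
move=> lt he hw; have d0 : 0 < t - `|l| by rewrite subr_gt0.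
have t0 : 0 <= t by rewrite (le_trans (normr_ge0 l))// ltW.
have C0 : 0 <= C by have := he 0%N; rewrite expr0 mulr1; exact: le_trans.
(* [C / (t - |l|)] is the fixed point of [c -> (|l| c + C) / t]; adding [|w 0|] starts the induction
   and is preserved because [|l| < t]. *)
exists (C / (t - `|l|) + `|w 0%N|); elim=> [|k ih].
  by rewrite expr0 mulr1 lerDr divr_ge0// ltW.
rewrite hw (le_trans (ler_normD _ _))// normrM.
apply: le_trans (lerD (ler_wpM2l (normr_ge0 l) ih) (he k)) _.
rewrite exprS !mulrA -mulrDl ler_wpM2r ?exprn_ge0// addrC -lerBrDr.
rewrite [X in _ <= X - _]mulrC -mulrBl mulrDr mulrCA divff ?gt_eqF// mulr1.
by rewrite lerDl mulr_ge0// ltW.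
Qed.

(* By Cayley-Hamilton a product of factors [B - z] vanishes; they are peeled
   off one at a time, each through a scalar recurrence. *)
Lemma mx_power_bound (n : nat) (B : 'M[algC]_n.+1) (t : algC) :
  (forall z, eigenvalue B z -> `|z| < t) ->
  exists C, forall k i j, `|(B ^+ k) i j| <= C * t ^+ k.
Proof.
move=> hB; have [rs hrs] := closed_field_poly_normal (char_poly B).
rewrite (monicP (char_poly_monic B)) scale1r in hrs.
(* [P] collects the factors moved to the right. The induction hypothesis bounds
   [B ^+ k * ((B - z) * P)], the inhomogeneous term in the recurrence for [B ^+ k * P]. *)
suff peel s : {subset s <= rs} -> forall P : 'M[algC]_n.+1,
    horner_mx B (\prod_(z <- s) ('X - z%:P)) * P = 0 ->
    exists C, forall k i j, `|(B ^+ k * P) i j| <= C * t ^+ k.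
  have [|C hC] := peel rs (fun _ => id) 1.
    by rewrite -hrs Cayley_Hamilton mul0r.
  by exists C => k i j; have := hC k i j; rewrite mulr1.
elim: s => [|z s ih] srs P.
  rewrite big_nil rmorph1 mul1r => ->; exists 0 => k i j.
  by rewrite mulr0 mxE normr0 mul0r.
rewrite big_cons mulrC rmorphM -mulrA => /ih[x xs|C hC].
  by apply: srs; rewrite in_cons xs orbT.
have zt : `|z| < t.
  apply: hB; rewrite eigenvalue_root_char hrs root_prod_XsubC.
  by apply: srs; rewrite mem_head.
have {hC} h i j : exists C', forall k, `|(B ^+ k * P) i j| <= C' * t ^+ k.
  apply: (geometric_recurrence zt (fun k => hC k i j)) => k.
  rewrite rmorphB /= horner_mx_X horner_mx_C.
  have -> : B ^+ k.+1 * P = z *: (B ^+ k * P) + B ^+ k * ((B - z%:M) * P).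
    rewrite mulrBl mulrBr -!mulmxE mul_scalar_mx -scalemxAr addrC subrK.
    by rewrite exprSr mulmxA.
  by rewrite [LHS]mxE [X in X + _]mxE.
have /choice[f hf] : forall p, exists C', forall k, `|(B ^+ k * P) p.1 p.2| <= C' * t ^+ k.
  by move=> p; exact: h.
have f0 p : 0 <= f p by have := hf p 0%N; rewrite !expr0 mulr1; exact: le_trans.
have t0 : 0 <= t by rewrite (le_trans (normr_ge0 z))// ltW.
exists (\sum_p f p) => k i j; apply: le_trans (hf (i, j) k) _.
rewrite ler_wpM2r ?exprn_ge0// (bigD1 (i, j))//= lerDl.
by apply: sumr_ge0 => p _.
Qed.

Lemma expanding_inv_eigenvalue (n : nat) (A : 'M[rat]_n.+1) (z : algC) :
  expanding A -> eigenvalue (map_mx ratr A^-1 : 'M[algC]_n.+1) z -> `|z| < 1.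
Proof.
move=> hA /eigenvalueP[v hv v0].
have uA : map_mx ratr A \is a @GRing.unit 'M[algC]_n.+1.
  by rewrite -[_ \is a _]/(_ \in unitmx) map_unitmx; exact: expanding_unit.
have AB : map_mx ratr A^-1 *m map_mx ratr A = 1%:M :> 'M[algC]_n.+1.
  by rewrite -map_mxM mulmxE mulVr ?map_mx1//; exact: expanding_unit.
have vE : v = z *: (v *m map_mx ratr A).
  by rewrite scalemxAl -hv -mulmxA AB mulmx1.
have z0 : z != 0 by apply: contraNneq v0 => z0; rewrite vE z0 scale0r.
have : eigenvalue (map_mx ratr A : 'M[algC]_n.+1) z^-1.
  apply/eigenvalueP; exists v => //.
  by rewrite [in RHS]vE scalerA mulVf// scale1r.
by move=> /hA; rewrite normfV invf_gt1// normr_gt0.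
Qed.

(** Eigenvalues live in [algC] and tiles over [R]; a bound with rational constants transfers from
    one to the other through [rat]. *)
Lemma expanding_inv_power (n : nat) (A : 'M[rat]_n.+1) : expanding A ->
  exists C t : rat, [/\ 0 <= C, 0 <= t, t < 1 &
    forall k i j, `|(A^-1 ^+ k) i j| <= C * t ^+ k].
Proof.
move=> hA; set B := map_mx ratr A^-1 : 'M[algC]_n.+1.
have [rs hrs] := closed_field_poly_normal (char_poly B).
rewrite (monicP (char_poly_monic B)) scale1r in hrs.
have rs1 z : eigenvalue B z <-> z \in rs.
  by rewrite eigenvalue_root_char hrs root_prod_XsubC.
(* [m] exceeds every [1 / (1 - |z|)], so that [1 - 1/m] exceeds every [|z|]; the sum stands in for a
   maximum. *)
pose m := (\sum_(z <- rs) Num.bound (1 - `|z|)^-1)%N.+1.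
pose t : rat := 1 - m%:R^-1.
have tE : ratr t = 1 - m%:R^-1 :> algC.
  by rewrite /t rmorphB /= rmorph1 fmorphV /= ratr_nat.
have zt z : eigenvalue B z -> `|z| < ratr t.
  move=> ez; have d0 : 0 < 1 - `|z|.
    by rewrite subr_gt0; exact: expanding_inv_eigenvalue ez.
  rewrite tE ltrBrDr addrC -ltrBrDr -[ltRHS]invrK ltf_pV2 ?posrE ?invr_gt0//.
  apply: lt_le_trans (archi_boundP _) _; first by rewrite invr_ge0 ltW.
  rewrite ler_nat /m ltnW// ltnS.
  have /rs1 zr := ez.
  by rewrite (perm_big _ (perm_to_rem zr)) big_cons leq_addr.
have [C hC] := mx_power_bound zt.
have m0 : 0 < m%:R :> rat by [].
have t0 : 0 <= t by rewrite subr_ge0 invf_le1// ler1n.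
have t1 : t < 1 by rewrite gtrBl invr_gt0.
have C0 : 0 <= C.
  by have := hC 0%N ord0 ord0; rewrite !expr0 mulr1; exact: le_trans.
exists (Num.bound C)%:R, t; split => // k i j.
rewrite -(ler_rat algC) ratr_norm rmorphM rmorphXn /= ratr_nat.
have -> : ratr ((A^-1 ^+ k) i j) = (B ^+ k) i j.
  by rewrite /B -(rmorphXn (map_mx (ratr : rat -> algC))) mxE.
apply: le_trans (hC k i j) _; rewrite ler_wpM2r ?exprn_ge0 ?ler0q//.
by rewrite ltW// archi_boundP.
Qed.

(** * Residue systems and digit sums *)

Section DigitSums.
Variables (n : nat) (M : 'M[rat]_n.+1).
Implicit Types x y : 'cV[rat]_n.+1.

(** The digit map [f] is a parameter so that residues ([r]) and digits of [D] ([val], which gives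
    [expansion]) share the same lemmas. *)
Definition digit_sum (T : Type) (f : T -> 'cV[rat]_n.+1) k (d : {ffun 'I_k -> T}) :=
  \sum_(i < k) M ^+ i *m f (d i).

Definition dcons (T : Type) k (c : T) (d : {ffun 'I_k -> T}) : {ffun 'I_k.+1 -> T} :=
  [ffun i => if unlift ord0 i is Some j then d j else c].

Definition dtail (T : Type) k (d : {ffun 'I_k.+1 -> T}) : {ffun 'I_k -> T} :=
  [ffun i => d (lift ord0 i)].

Lemma dconsK (T : Type) k (d : {ffun 'I_k.+1 -> T}) : dcons (d ord0) (dtail d) = d.
Proof.
by apply/ffunP => i; rewrite ffunE; case: unliftP => [j ->|->]; rewrite ?ffunE.
Qed.

Lemma digit_sum0 (T : Type) (f : T -> 'cV[rat]_n.+1) (d : {ffun 'I_0 -> T}) :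
  digit_sum f d = 0.
Proof. by rewrite /digit_sum big_ord0. Qed.

Lemma digit_sum_cons (T : Type) (f : T -> 'cV[rat]_n.+1) k c (d : {ffun 'I_k -> T}) :
  digit_sum f (dcons c d) = f c + M *m digit_sum f d.
Proof.
rewrite /digit_sum big_ord_recl expr0 mul1mx ffunE unlift_none mulmx_sumr.
congr (_ + _); apply: eq_bigr => i _.
by rewrite ffunE liftK mulmxA mulmxE exprS.
Qed.

Lemma digit_sum_Zpoly (T : Type) (f : T -> 'cV[rat]_n.+1) k (d : {ffun 'I_k -> T}) :
  (forall c, Zpoly M (f c)) -> Zpoly M (digit_sum f d).
Proof. by move=> hf; apply: Zpoly_sum => i _; apply: Zpoly_exp. Qed.

Lemma residues_exist : M \is a GRing.unit ->
  exists r : 'I_(quot_card M) -> 'cV[rat]_n.+1,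
  [/\ forall i, Zpoly M (r i),
      forall x, Zpoly M x -> exists i y, Zpoly M y /\ x = r i + M *m y &
      forall i j y, Zpoly M y -> r i = r j + M *m y -> i = j].
Proof.
move=> uM; have fin := finite_cosets uM.
pose s := enum_fset (fset_set (cosets M)).
pose cos x : set 'cV[rat]_n.+1 := [set x + M *m y | y in Zpoly M].
have ss : size s = quot_card M by [].
have sP C : C \in s <-> cosets M C.
  by rewrite -[C \in s]/(C \in fset_set _) in_fset_set// inE.
have /choice[r hr] (i : 'I_(quot_card M)) :
    exists x, Zpoly M x /\ cos x = nth set0 s i.
  have /sP[x hx <-] : nth set0 s i \in s by rewrite mem_nth// ss.
  by exists x.
have cosxx x : cos x x by exists 0; [exact: Zpoly0|rewrite mulmx0 addr0].
exists r; split=> [i|x hx|i j y hy E]; first by have [] := hr i.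
  have /sP xs : cosets M (cos x) by exists x.
  have lt : (index (cos x) s < quot_card M)%N by rewrite -ss index_mem.
  exists (Ordinal lt); have [_ /= hE] := hr (Ordinal lt).
  have : cos (r (Ordinal lt)) x by rewrite hE nth_index.
  by move=> [y hy E]; exists y.
have cE : cos (r i) = cos (r j).
  rewrite E; apply/seteqP; split=> _ [v hv <-].
    by exists (y + v); [exact: ZpolyD|rewrite mulmxDr addrA].
  by exists (v - y); [exact: ZpolyB|rewrite mulmxBr -addrA [M *m y + _]addrC subrK].
have us : uniq s := fset_uniq _.
apply/val_inj/eqP; rewrite -(nth_uniq set0 (ltn_ord i) (ltn_ord j) us).
by rewrite -(hr i).2 -(hr j).2 cE.
Qed.

Section Residues.
Hypothesis uM : M \is a GRing.unit.
Variable r : 'I_(quot_card M) -> 'cV[rat]_n.+1.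
Hypothesis rM : forall i, Zpoly M (r i).
Hypothesis r_surj : forall x, Zpoly M x -> exists i y, Zpoly M y /\ x = r i + M *m y.
Hypothesis r_inj : forall i j y, Zpoly M y -> r i = r j + M *m y -> i = j.

Lemma residue_sum_surj k x : Zpoly M x ->
  exists (d : {ffun 'I_k -> 'I_(quot_card M)}) y,
    Zpoly M y /\ x = digit_sum r d + M ^+ k *m y.
Proof.
elim: k x => [|k ih] x hx.
  have [i _] := r_surj hx.
  by exists [ffun=> i], x; rewrite digit_sum0 expr0 mul1mx add0r.
have [i [y [/ih[d [y' [hy' ->]]] ->]]] := r_surj hx.
exists (dcons i d), y'; split => //.
by rewrite digit_sum_cons mulmxDr addrA mulmxA mulmxE exprS.
Qed.

Lemma residue_sum_inj k (d d' : {ffun 'I_k -> 'I_(quot_card M)}) y :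
  Zpoly M y -> digit_sum r d = digit_sum r d' + M ^+ k *m y -> d = d'.
Proof.
elim: k d d' y => [|k ih] d d' y hy; first by move=> _; apply/ffunP => -[].
rewrite -(dconsK d) -(dconsK d') !digit_sum_cons => E.
have E0 : d ord0 = d' ord0.
  apply: (@r_inj _ _ (digit_sum r (dtail d') + M ^+ k *m y - digit_sum r (dtail d))).
    by apply: ZpolyB; [apply: ZpolyD => //; [exact: digit_sum_Zpoly|exact: Zpoly_exp]|exact: digit_sum_Zpoly].
  rewrite mulmxBr mulmxDr mulmxA mulmxE -exprS addrA addrA -E.
  by rewrite addrK.
rewrite E0; congr (dcons _ _); apply: (ih _ _ y) => //.
move: E; rewrite E0 -addrA => /addrI; rewrite exprS -mulmxE -mulmxA -mulmxDr.
by move/(congr1 (mulmx M^-1)); rewrite !mulmxA !mulmxE mulVr// !mul1mx.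
Qed.

End Residues.
End DigitSums.

(** * Balls of the representation space *)

Section RepresentationBalls.
Variables (R : realType) (n : nat) (A : base n).
Implicit Types (x y : 'cV[rat]_n.+1) (p q : Zcompl R A) (u v : cseq R A) (k : int).

Let uB : mxB A \is a GRing.unit := mxB_unit A.
Local Notation b := ((base_b A)%:R : R).
Let b1 : 1 < b := base_b_gt1 R A.
Let b0 : 0 < b := lt_trans ltr01 b1.

(** An open subgroup, the counterpart of [level (mxB A) k] in the completion ([Yball_class],
    [Yball_emb]). *)
Definition Yball k : set (Zcompl R A) := [set p : Zcompl R A | mdist p 0 <= b ^ (- k)].

Lemma ZclassB u v : Zclass (u - v) = Zclass u - Zclass v.
Proof. exact: (raddfB (\pi_(Quotient.quot (@null_seqs R n A)))%qT). Qed.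

Lemma Zclass0 : Zclass 0 = 0 :> Zcompl R A.
Proof. exact: (raddf0 (\pi_(Quotient.quot (@null_seqs R n A)))%qT). Qed.

Lemma mdist_class u v :
  mdist (Zclass u) (Zclass v) = limn (fun i => dB R A (u i) (v i)).
Proof. by rewrite -[LHS]/(Zcompl_dist _ _) dist_Zclass. Qed.

Lemma mdistB p q : mdist p q = mdist (p - q) (0 : Zcompl R A).
Proof.
rewrite -[p]Zclass_repr -[q]Zclass_repr -ZclassB -Zclass0 !mdist_class.
by congr (limn _); apply/funext => i; rewrite /dB subr0.
Qed.

Lemma Yball_mdist k p q : mdist p q <= b ^ (- k) <-> Yball k (p - q).
Proof. by rewrite mdistB. Qed.

Lemma Yball_class k u : Yball k (Zclass u) <->
  exists N, forall i, (N <= i)%N -> level (mxB A) k (u i).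
Proof.
have cu : (fun i => dB R A (u i) 0) @ \oo --> mdist (Zclass u) (0 : Zcompl R A).
  by rewrite -Zclass0 mdist_class; exact: (@cvg_dB R n A u 0).
split=> [h|[N hN]].
  (* A strict bound passes from the limit to the sequence. Nothing is lost by weakening the radius
     to [b ^ (1 - k)]: the nonzero values of [dB] are powers of [b], so being below it means being
     at most [b ^ (- k)]. *)
  have lt : mdist (Zclass u) (0 : Zcompl R A) < b ^ (- (k - 1)).
    by apply: le_lt_trans h _; rewrite ltr_eXz2l// ltrN2 gtrBl.
  have [N _ hN] : \forall i \near \oo, dB R A (u i) 0 < b ^ (- (k - 1)).
    exact: (cvgr_lt _ cu).
  exists N => i /hN /=; rewrite /dB subr0.
  case: (nuP R (cseq_laurent u i)) => [h' _|j hj]; first exact: h'.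
  by rewrite ltr_eXz2l// ltrN2 => kj; apply/hj; rewrite -lezD1 subrK in kj.
rewrite /Yball /= -(cvg_lim _ cu)//; apply: limr_le; first by apply/cvg_ex; eexists; exact: cu.
near=> i; rewrite /dB subr0; apply/(bexp_le _ _ (cseq_laurent u i)); apply: hN.
by near: i; exists N.
Unshelve. all: by end_near. Qed.

Lemma Yball0 k : Yball k 0.
Proof. by rewrite /Yball /= mdistxx exprz_ge0// ltW. Qed.

Lemma YballB k p q : Yball k p -> Yball k q -> Yball k (p - q).
Proof.
rewrite -[p]Zclass_repr -[q]Zclass_repr -ZclassB => /Yball_class[N hN] /Yball_class[N' hN'].
apply/Yball_class; exists (maxn N N') => i; rewrite geq_max => /andP[Ni N'i].
by apply: levelB; [exact: hN|exact: hN'].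
Qed.

Lemma YballN k p : Yball k p -> Yball k (- p).
Proof. by move=> hp; rewrite -sub0r; apply: YballB => //; exact: Yball0. Qed.

Lemma YballD k p q : Yball k p -> Yball k q -> Yball k (p + q).
Proof. by move=> hp hq; rewrite -[q]opprK; apply: YballB => //; exact: YballN. Qed.

Lemma Yball_le j k : j <= k -> Yball k `<=` Yball j.
Proof. by move=> jk p /le_trans; apply; rewrite ler_eXz2l// lerN2. Qed.

Lemma Zclass_cst x : Zlaurent (mxB A) x ->
  exists2 u, Zclass u = Zemb R A x & forall i, u i = x.
Proof.
by move=> hx; eexists; [reflexivity|move=> i; rewrite insub_cst].
Qed.

Lemma Yball_emb k x : Zlaurent (mxB A) x ->
  Yball k (Zemb R A x) <-> level (mxB A) k x.
Proof.
move=> /Zclass_cst[u <- ux]; rewrite Yball_class; split=> [[N hN]|h].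
  by rewrite -(ux N); exact: hN.
by exists 0%N => i _; rewrite ux.
Qed.

Lemma ZembB x y : Zlaurent (mxB A) x -> Zlaurent (mxB A) y ->
  Zemb R A (x - y) = Zemb R A x - Zemb R A y.
Proof.
move=> hx hy; rewrite -ZclassB; congr Zclass; apply/val_inj/funext => i /=.
have E : forall z, Zlaurent (mxB A) z -> cval (insubd (0 : cseq R A) (fun=> z)) i = z.
  by move=> z hz; rewrite insub_cst.
by rewrite E; [rewrite -[RHS]/(cval _ i - cval _ i) !E|exact: (ZlaurentB uB)].
Qed.

Lemma Zemb0 : Zemb R A 0 = 0.
Proof.
by have h := Zlaurent0 uB; rewrite -[X in Zemb R A X](subrr 0) ZembB// subrr.
Qed.

Lemma ZembD x y : Zlaurent (mxB A) x -> Zlaurent (mxB A) y ->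
  Zemb R A (x + y) = Zemb R A x + Zemb R A y.
Proof.
move=> hx hy; have h0 := Zlaurent0 uB; have hN := ZlaurentB uB h0 hy.
by rewrite -[y in LHS]opprK -[- y]sub0r ZembB// ZembB// Zemb0 sub0r opprK.
Qed.

Lemma Zcompl_mulAB p q :
  Zcompl_mulA (p - q) = Zcompl_mulA p - Zcompl_mulA q.
Proof.
rewrite -[p]Zclass_repr -[q]Zclass_repr -ZclassB !Zcompl_mulA_class -ZclassB.
congr Zclass; apply/val_inj/funext => i /=.
exact: mulmxBr.
Qed.

Lemma Yball_mulA k p : Yball k (Zcompl_mulA p) <-> Yball (k + 1) p.
Proof.
rewrite -[p]Zclass_repr Zcompl_mulA_class !Yball_class.
by split=> -[N hN]; exists N => i /hN /level_mulA.
Qed.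

Lemma Yball_iter_mulA (m : nat) k p :
  Yball k (iter m (@Zcompl_mulA R n A) p) <-> Yball (k + m%:Z) p.
Proof.
elim: m k => [|m ih] k; first by rewrite addr0.
by rewrite iterS Yball_mulA ih -addrA [1 + _]addrC -PoszD addn1.
Qed.

Lemma iter_mulAB (m : nat) p q : iter m (@Zcompl_mulA R n A) (p - q) =
  iter m (@Zcompl_mulA R n A) p - iter m (@Zcompl_mulA R n A) q.
Proof. by elim: m => // m ih; rewrite !iterS ih Zcompl_mulAB. Qed.

Lemma Zlaurent_powA (m : nat) x : Zlaurent (mxB A) x ->
  Zlaurent (mxB A) (mxA A ^+ m *m x).
Proof.
move=> hx; elim: m => [|m ih]; first by rewrite expr0 mul1mx.
by rewrite exprS -mulmxE -mulmxA; exact: Zlaurent_mulA.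
Qed.

Lemma iter_mulA_emb (m : nat) x : Zlaurent (mxB A) x ->
  iter m (@Zcompl_mulA R n A) (Zemb R A x) = Zemb R A (mxA A ^+ m *m x).
Proof.
move=> hx; elim: m => [|m ih]; first by rewrite expr0 mul1mx.
by rewrite iterS ih Zcompl_mulA_emb ?exprS -?mulmxE -?mulmxA//; exact: Zlaurent_powA.
Qed.

Lemma Zemb_dense k p : exists2 x, Zlaurent (mxB A) x & Yball k (p - Zemb R A x).
Proof.
rewrite -[p]Zclass_repr; set u := repr p.
have [N hN] := (cseqP u).2 _ (exprz_gt0 (- k) b0).
have hx := cseq_laurent u N; exists (u N) => //.
have [v <- vx] := Zclass_cst hx; rewrite -ZclassB; apply/Yball_class.
exists N => i Ni; rewrite -[(u - v) i]/(u i - v i) vx.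
apply/(bexp_le R _ (ZlaurentB uB (cseq_laurent u i) hx)); apply: ltW.
exact: hN.
Qed.

Lemma Yball_exhaust p : exists k, Yball k p.
Proof.
have [x hx h] := Zemb_dense 0 p; have /(ZlaurentP uB)[j hj] := hx.
exists (Num.min 0 j); rewrite -(subrK (Zemb R A x) p); apply: YballD.
  by apply: Yball_le h; rewrite ge_min lexx.
by apply: (@Yball_le _ j); [rewrite ge_min lexx orbT|exact/Yball_emb].
Qed.

Lemma Zintegral_Yball : @Zintegral R n A = Yball 0.
Proof.
apply/seteqP; split=> p; rewrite /Zintegral /Yball /= -[p]Zclass_repr Zcompl_nu_class;
  have [[-> _ ->]|[j [-> _ ->]]] := cvg_nu (repr p).
- by move=> _; rewrite exprz_ge0// ltW.
- by rewrite lee_fin ler0z ler_eXz2l// lerN2.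
- by rewrite leey.
- by rewrite lee_fin ler0z ler_eXz2l// lerN2.
Qed.

Lemma open_Yball k q : open [set p | Yball k (p - q)].
Proof.
rewrite openE => p /= hp; apply/nbhs_ballP; exists (b ^ (- k)); first exact: exprz_gt0.
move=> p'; rewrite ballEmdist /= => /ltW/Yball_mdist h.
have -> : p' - q = (p - q) - (p - p') by rewrite opprB [RHS]addrC subrKA.
exact: YballB.
Qed.

End RepresentationBalls.

(** * Borel sets and translation invariance of Lebesgue measure *)

Lemma borel_open (T : ptopologicalType) (U : set T) :
  open U -> measurable (U : set (borel T)).
Proof. by move=> oU; exact: sub_sigma_algebra. Qed.

Lemma borel_closed (T : ptopologicalType) (U : set T) :
  closed U -> measurable (U : set (borel T)).
Proof.
move=> cU; rewrite -[U]setCK; apply: measurableC; apply: borel_open.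
exact: closed_openC.
Qed.

Lemma borel_continuous (T U : ptopologicalType) (f : T -> U) :
  continuous f -> measurable_fun setT (f : borel T -> borel U).
Proof.
move=> cf; apply: (@measurability _ _ (borel T) (borel U) setT f (@open U)) => // _ [V oV <-].
by rewrite setTI; apply: borel_open; apply: open_comp => // x _; exact: cf.
Qed.

Section EuclideanSpace.
Variables (R : realType) (n : nat).
Local Notation V := 'cV[R]_n.+1.
Implicit Types (a c v x : V).

Definition cbox a c : set V := [set x | forall i, a i 0 <= x i 0 <= c i 0].

Lemma mulmx_coord_continuous (M : 'M[R]_n.+1) i :
  continuous (fun x : V => (M *m x) i 0).
Proof.
have -> : (fun x : V => (M *m x) i 0) = (fun x => \sum_j M i j * x j 0).
  by apply/funext => x; rewrite mxE.
have ac : continuous (fun z : R^o * R^o => z.1 + z.2) by exact: add_continuous.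
apply: (@continuous_big R^o 'I_n.+1 +%R 0 xpredT ac V (index_enum _) (fun j (x : V) => M i j * x j 0)).
move=> j _ x; have cc : continuous (fun x : V => x j 0) by exact: coord_continuous.
exact: (cvgM (cvg_cst (M i j)) (cc x)).
Qed.

Lemma closed_mulmx_box (M : 'M[R]_n.+1) a c :
  closed [set x : V | cbox a c (M *m x)].
Proof.
have -> : [set x : V | cbox a c (M *m x)] = \bigcap_(i in setT)
    ((fun x : V => (M *m x) i 0) @^-1` [set t | a i 0 <= t <= c i 0]).
  by apply/seteqP; split=> x /= h i; [move=> _; exact: h|exact: (h i)].
apply: closed_bigI => i _; apply: closed_comp.
  by move=> x _; exact: mulmx_coord_continuous.
have -> : [set t | a i 0 <= t <= c i 0] = `[a i 0, c i 0]%classic.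
  by apply/seteqP; split=> t /=; rewrite in_itv.
exact: interval_closed.
Qed.

Lemma closed_cbox a c : closed (cbox a c).
Proof.
have := @closed_mulmx_box 1%:M a c.
by rewrite (_ : [set x | _] = cbox a c)//; apply/seteqP; split=> x /=; rewrite mul1mx.
Qed.

Lemma cboxI a c a' c' : cbox a c `&` cbox a' c' =
  cbox (\col_i Num.max (a i 0) (a' i 0)) (\col_i Num.min (c i 0) (c' i 0)).
Proof.
apply/seteqP; split=> x /= => [[h h'] i|h].
  have /andP[h1 h2] := h i; have /andP[h3 h4] := h' i.
  by rewrite !mxE ge_max le_min h1 h2 h3 h4.
by split=> i; have := h i; rewrite !mxE ge_max le_min => /andP[/andP[h1 h2] /andP[h3 h4]];
  rewrite ?h1 ?h2 ?h3 ?h4.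
Qed.

(** The corners are rational so that the union is countable, which places open sets in the
    sigma-algebra generated by boxes. *)
Lemma open_cover_cbox (U : set V) : open U ->
  U = \bigcup_(q in setT) (let B := cbox (map_mx ratr q.1) (map_mx ratr q.2) in
    if `[< B `<=` U >] then B else set0)
    :> set V.
Proof.
move=> oU; apply/seteqP; split=> [x Ux|x [q _] /=]; last first.
  by case: ifP => // /asboolP; apply.
have [e /= e0 eU] : exists2 e, 0 < e & ball x e `<=` U.
  by move: oU; rewrite openE => /(_ _ Ux) /nbhs_ballP[e]; exists e.
have /choice[f hf] (i : 'I_n.+1) : exists q : rat, x i 0 - e < ratr q < x i 0.
  have [|q] := @rat_in_itvoo R (x i 0 - e) (x i 0); first by rewrite gtrBl.
  by rewrite in_itv; exists q.
have /choice[g hg] (i : 'I_n.+1) : exists q : rat, x i 0 < ratr q < x i 0 + e.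
  have [|q] := @rat_in_itvoo R (x i 0) (x i 0 + e); first by rewrite ltrDl.
  by rewrite in_itv; exists q.
exists (\col_i f i, \col_i g i) => //=; case: ifP => [_|/asboolP]; last first.
  case=> y hy; apply: eU; split => // i j; rewrite !ord1.
  have := hy i; rewrite !mxE /ball /= => /andP[h1 h2].
  have /andP[h3 _] := hf i; have /andP[_ h4] := hg i.
  by rewrite ltr_distlC (lt_le_trans h3 h1) (le_lt_trans h2 h4).
move=> i; rewrite !mxE; have /andP[_ /ltW->] := hf i.
by have /andP[/ltW-> _] := hg i.
Qed.

Definition boxes : set (set V) := [set cbox p.1 p.2 | p in [set: V * V]].

Lemma borel_boxes : @measurable _ (borel V) = <<s boxes >>.
Proof.
apply/seteqP; split; apply: smallest_sub.
- exact: smallest_sigma_algebra.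
- move=> U oU; rewrite (open_cover_cbox oU).
  apply: (@countable_bigcupT_measurable _ (g_sigma_algebraType boxes)) => // q.
  rewrite /=; case: ifP => _; last exact: measurable0.
  by apply: sub_sigma_algebra; exists (map_mx ratr q.1, map_mx ratr q.2).
- exact: smallest_sigma_algebra.
- by move=> _ [p _ <-]; apply: borel_closed; exact: closed_cbox.
Qed.

Lemma cbox_shift a c v : [set x | cbox a c (x - v)] = cbox (a + v) (c + v).
Proof.
apply/seteqP; split=> x /= h i; have := h i.
  by rewrite !mxE lerBrDr lerBlDr.
by rewrite !mxE lerBrDr lerBlDr.
Qed.

Variable lam : {measure set (borel V) -> \bar R}.
Hypothesis hlam : is_lebesgue lam.

Lemma lebesgue_cbox0 a c i : c i 0 < a i 0 -> cbox a c = set0.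
Proof.
move=> h; rewrite -subset0 => x /(_ i) /andP[h1 h2].
by have := le_trans h1 h2; rewrite leNgt h.
Qed.

Lemma lebesgue_cbox_lty a c : (lam (cbox a c) < +oo)%E.
Proof.
have [h|/existsNP[i /negP]] := pselect (forall i, a i 0 <= c i 0).
  by rewrite hlam// ltry.
by rewrite -ltNge => /lebesgue_cbox0 ->; rewrite measure0.
Qed.

Lemma lebesgue_cbox_shift a c v : lam (cbox (a + v) (c + v)) = lam (cbox a c).
Proof.
have [h|/existsNP[i /negP]] := pselect (forall i, a i 0 <= c i 0).
  rewrite !hlam//; last by move=> i; rewrite !mxE lerD2r.
  by congr (_%:E); apply: eq_bigr => i _; rewrite !mxE opprD addrACA subrr addr0.
rewrite -ltNge => h; rewrite (lebesgue_cbox0 h) (@lebesgue_cbox0 _ _ i)//.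
by rewrite !mxE ltrD2r.
Qed.

(** [is_lebesgue] prescribes values on boxes only. The push-forward of [lam] under the translation
    agrees with [lam] on boxes, which are stable under intersection, generate the Borel sets and
    exhaust the space with finite measure; uniqueness of measures does the rest. *)
Lemma lebesgue_shift (S : set (borel V)) v : measurable S ->
  lam [set x : V | S (x - v)] = lam S.
Proof.
have cs : continuous (fun x : V => x - v).
  by move=> x; exact: (cvgB cvg_id (cvg_cst v)).
have mf := borel_continuous cs.
pose g k : set V := cbox (const_mx (- k%:R)) (const_mx k%:R).
move=> mS; apply/esym.
pose m2 : {measure set (borel V) -> \bar R} :=
  measure_function_pushforward__canonical__measure_function_Measure lam mf.
rewrite -[RHS]/(m2 S).
refine (@measure_unique _ R (borel V) boxes g _ _ _ _ lam m2 _ _ S mS).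
- exact: borel_boxes.
- move=> _ _ [p _ <-] [q _ <-]; rewrite cboxI.
  by exists (\col_i Num.max (p.1 i 0) (q.1 i 0), \col_i Num.min (p.2 i 0) (q.2 i 0)).
- by move=> k; exists (const_mx (- k%:R), const_mx k%:R).
- apply/seteqP; split=> // x _.
  pose s := \sum_i `|x i 0|; exists (Num.bound s) => // i.
  rewrite !mxE -ler_norml; apply: le_trans (ltW (archi_boundP _)).
    by rewrite /s (bigD1 i)//= lerDl sumr_ge0.
  by rewrite sumr_ge0.
- move=> _ [p _ <-]; rewrite -[RHS]/(lam [set x : V | cbox p.1 p.2 (x - v)]).
  by rewrite cbox_shift lebesgue_cbox_shift.
- by move=> k; exact: lebesgue_cbox_lty.
Qed.

End EuclideanSpace.

(** * Measure of finite unions and contraction of [A^-1] *)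

Section FiniteUnions.
Context d (T : measurableType d) (R : realType).
Variable mu : {measure set T -> \bar R}.
Local Open Scope ereal_scope.

Lemma fsum_finType (I : finType) (f : I -> \bar R) :
  \sum_(i \in [set: I]) f i = \sum_i f i.
Proof.
rewrite [RHS](@bigfs _ _ _ _ _ xpredT) ?index_enum_uniq//.
  by congr (\sum_(i \in _) _); apply/seteqP; split.
by move=> i _ /negP[]; exact: mem_index_enum.
Qed.

Lemma sume_cst (I : finType) (c : \bar R) : \sum_(i : I) c = (#|I|%:R)%:E * c.
Proof. by rewrite mule_natl sumr_const. Qed.

Lemma measure_cover_le (I : finType) (F : I -> set T) (S : set T) (c : \bar R) :
  measurable S -> (forall i, measurable (F i)) -> (forall i, mu (F i) <= c) ->
  S `<=` \bigcup_(i in setT) F i -> mu S <= (#|I|%:R)%:E * c.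
Proof.
move=> mS mF hc SF.
have h := content_sub_fsum mu (@finite_finset _ _) (fun i _ => mF i) mS SF.
apply: (le_trans h); rewrite fsum_finType -sume_cst.
by apply: lee_sum => i _; exact: hc.
Qed.

Lemma measure_disjoint_union (I : finType) (F : I -> set T) (c : \bar R) :
  (forall i, measurable (F i)) -> (forall i, mu (F i) = c) ->
  (forall i j x, F i x -> F j x -> i = j) ->
  mu (\bigcup_(i in setT) F i) = (#|I|%:R)%:E * c.
Proof.
move=> mF hc dF; rewrite measure_fin_bigcup//; last 1 first.
- by move=> i j _ _ [x []]; exact: dF.
- by rewrite fsum_finType -sume_cst; apply: eq_bigr => i _; exact: hc.
- exact: finite_finset.
Qed.

End FiniteUnions.

Section Contraction.
Variables (R : realType) (n : nat) (A : 'M[rat]_n.+1).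
Hypothesis hA : expanding A.
Local Notation V := 'cV[R]_n.+1.
Local Notation toR := (map_mx (ratr : rat -> R)).
Local Notation MA := (map_mx (ratr : rat -> R) A : 'M[R]_n.+1).
Local Notation MB := (map_mx (ratr : rat -> R) A^-1 : 'M[R]_n.+1).

Lemma ratr_mulmx (M : 'M[rat]_n.+1) (x : 'cV[rat]_n.+1) k :
  (map_mx ratr M : 'M[R]_n.+1) ^+ k *m toR x = toR (M ^+ k *m x).
Proof. by rewrite map_mxM (rmorphXn (map_mx (ratr : rat -> R))). Qed.

Lemma MA_MB k (x : V) : MA ^+ k *m (MB ^+ k *m x) = x.
Proof.
rewrite mulmxA mulmxE -!(rmorphXn (map_mx (ratr : rat -> R))) -rmorphM.
by rewrite exprVn divrr ?rmorph1 ?mul1mx// unitrX//; exact: expanding_unit.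
Qed.

Lemma MB_MA k (x : V) : MB ^+ k *m (MA ^+ k *m x) = x.
Proof.
rewrite mulmxA mulmxE -!(rmorphXn (map_mx (ratr : rat -> R))) -rmorphM.
by rewrite exprVn mulVr ?rmorph1 ?mul1mx// unitrX//; exact: expanding_unit.
Qed.

Lemma inv_power_contraction : exists C t : R, [/\ 0 <= C, 0 <= t, t < 1 &
  forall k (x : V) (e : R), (forall i, `|x i 0| <= e) ->
  forall i, `|(MB ^+ k *m x) i 0| <= C * t ^+ k * e].
Proof.
have [C [t [C0 t0 t1 h]]] := expanding_inv_power hA.
(* The factor [n.+1] counts the entries in a row, turning an entrywise bound into a sup-norm
   bound. *)
exists (n.+1%:R * ratr C), (ratr t); split.
- by rewrite mulr_ge0// ler0q.
- by rewrite ler0q.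
- by rewrite -[1](rmorph1 (ratr : rat -> R)) ltr_rat.
move=> k x e he i; rewrite mxE; apply: le_trans (ler_norm_sum _ _ _) _.
apply: (@le_trans _ _ (\sum_(j < n.+1) ratr C * ratr t ^+ k * e)).
  apply: ler_sum => j _; rewrite normrM ler_pM//.
  rewrite -(rmorphXn (map_mx (ratr : rat -> R))) mxE -ratr_norm -rmorphXn -rmorphM.
  by rewrite ler_rat.
rewrite sumr_const card_ord -[leLHS]mulr_natl; move: (ratr C) (ratr t) => c s.
by rewrite !mulrA.
Qed.

Lemma inv_power_bounded : exists2 K : R, 0 <= K &
  forall k (x : V) (e : R), (forall i, `|x i 0| <= e) ->
  forall i, `|(MB ^+ k *m x) i 0| <= K * e.
Proof.
have [C [t [C0 t0 t1 h]]] := inv_power_contraction.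
exists C => // k x e he i; apply: le_trans (h k x e he i) _.
have e0 : 0 <= e by apply: le_trans (he i).
by rewrite ler_wpM2r// ler_piMr// exprn_ile1// ltW.
Qed.

End Contraction.

(** * Tiles *)

Section Tiles.
Variables (R : realType) (n : nat) (A : base n).
Local Notation V := 'cV[R]_n.+1.
Local Notation Y := (Zcompl R A).
Local Notation toR := (map_mx (ratr : rat -> R)).
Local Notation MA := (map_mx (ratr : rat -> R) (mxA A) : 'M[R]_n.+1).
Local Notation MB := (map_mx (ratr : rat -> R) (mxB A) : 'M[R]_n.+1).
Local Notation a := (quot_card (mxA A)).
Variable lam : {measure set (borel V) -> \bar R}.
Hypothesis hlam : is_lebesgue lam.
Variable muB : {measure set (borel Y) -> \bar R}.
Hypothesis hmuB : is_haar muB.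
Hypothesis hmuB1 : muB (@Zintegral R n A) = 1%E.

Let uA : mxA A \is a GRing.unit := expanding_unit (@base_expanding n A).
Let uB : mxB A \is a GRing.unit := mxB_unit A.

Definition Ycoset k (y : Y) : set Y := [set p | Yball k (p - y)].

Lemma measurable_Ycoset k y : measurable (Ycoset k y : set (borel Y)).
Proof. by apply: borel_open; exact: open_Yball. Qed.

Lemma haar_Ycoset k y : muB (Ycoset k y) = muB (Ycoset k 0).
Proof.
have [h _ _] := hmuB; rewrite -[RHS](h _ y); last exact: measurable_Ycoset.
congr (muB _); apply/seteqP; split=> p /=.
  by move=> hp; exists (p - y); [rewrite /Ycoset /= subr0|rewrite addrC subrK].
by move=> [q hq <-]; rewrite /Ycoset /= addrC addKr -[q]subr0.
Qed.

Lemma haar_Ycoset1 y : muB (Ycoset 0 y) = 1%E.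
Proof.
rewrite haar_Ycoset -hmuB1 Zintegral_Yball; congr (muB _).
by apply/seteqP; split=> p; rewrite /Ycoset /= subr0.
Qed.

(** By density of [Z^n(B)], countably many cosets of [Z^n[[B]]], each of measure 1, cover the space.
    Vectors outside [Z^n(B)] are sent to 0 by [Zemb] and merely repeat a coset. *)
Lemma haar_sigma_finite : sigma_finite setT muB.
Proof.
exists (fun i => if choice.unpickle i is Some x then Ycoset 0 (Zemb R A x) else set0).
  apply/esym/seteqP; split=> // p _; have [x _ hx] := Zemb_dense 0 p.
  by exists (choice.pickle x) => //; rewrite choice.pickleK.
move=> i; case: choice.unpickle => [x|]; last by rewrite measure0.
by split; [exact: measurable_Ycoset|rewrite [ltLHS]haar_Ycoset1 ltry].
Qed.

Let haar_isSFinite := isSFinite.Build _ _ _ (Measure.sort muB)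
  (sfinite_measure_sigma_finite haar_sigma_finite).
Let haar_isSigmaFinite := isSigmaFinite.Build _ _ _ (Measure.sort muB)
  haar_sigma_finite.

(* Convertible to [muB] as a function, so that [muA] below is [lam \x muB]. *)
Definition haar_sf : {sigma_finite_measure set (borel Y) -> \bar R} :=
  HB.pack_for (SigmaFiniteMeasure.type (borel Y) R) (Measure.sort muB)
    haar_isSFinite haar_isSigmaFinite.

Definition muA : {measure set (borel V * borel Y) -> \bar R} :=
  product_measure1 lam haar_sf.

Lemma muA_rect (S1 : set (borel V)) (S2 : set (borel Y)) :
  measurable S1 -> measurable S2 -> muA (S1 `*` S2) = (lam S1 * muB S2)%E.
Proof. by move=> m1 m2; exact: (product_measure1E lam haar_sf m1 m2). Qed.

(* A translate of [A^-k] applied to (a cube of side [d]) * [Z^n[[B]]]; the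
   translation [v] is measured after applying [A^k], and [y] before. *)
Definition tile (k : nat) (d : R) (v : V) (y : Y) : set (borel V * borel Y) :=
  [set x : V | cbox v (v + const_mx d) (MA ^+ k *m x)] `*` Ycoset k y.

Lemma measurable_tile_base k (v w : V) :
  measurable ([set x : V | cbox v w (MA ^+ k *m x)] : set (borel V)).
Proof. by apply: borel_closed; exact: closed_mulmx_box. Qed.

Lemma measurable_tile k d v y : measurable (tile k d v y).
Proof. by apply: measurableX; [exact: measurable_tile_base|exact: measurable_Ycoset]. Qed.

Lemma muA_tile k d v y : muA (tile k d v y) = muA (tile k d 0 0).
Proof.
rewrite /tile !muA_rect ?haar_Ycoset; try exact: measurable_Ycoset;
  try exact: measurable_tile_base.
congr (_ * _)%E.
rewrite -[RHS](lebesgue_shift hlam (MB ^+ k *m v)); last exact: measurable_tile_base.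
congr (lam _); apply/seteqP; split=> x /= h i; have := h i;
  rewrite mulmxBr (MA_MB (@base_expanding n A)) add0r !mxE subr_ge0 lerBlDl;
  by rewrite ?[d + _]addrC.
Qed.


(** For [w] in both modules [N w] is integral, and [d = 1 / (2N)] forces its coordinates below 1 in
    absolute value, hence to 0. *)
Lemma lattice_separation : exists2 d : R, 0 < d & forall w : 'cV[rat]_n.+1,
  Zpoly (mxA A) w -> Zpoly (mxB A) w -> (forall i, `|ratr (w i 0)| <= d) -> w = 0.
Proof.
have [N N0 hN] := Zpoly_inter_denom uA.
have N2 : 0 < (N.*2)%:R :> R by rewrite ltr0n double_gt0.
exists ((N.*2)%:R)^-1 => [|w wA wB wd]; first by rewrite invr_gt0.
have [z hz] := hN w wA wB; suff z0 : z = 0.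
  have /eqP := hz; rewrite z0 zvec0 scaler_eq0 pnatr_eq0 eqn0Ngt N0 /=.
  by move/eqP.
apply/matrixP => i j; rewrite ord1 [RHS]mxE; apply/eqP; rewrite -absz_eq0 -leqn0 -ltnS.
have : `|(z i 0)%:~R| < 1 :> R.
  have -> : (z i 0)%:~R = N%:R * ratr (w i 0) :> R.
    have /matrixP/(_ i 0) := hz; rewrite !mxE => hzi.
    by rewrite -(ratr_int _ (z i 0)) -hzi rmorphM /= ratr_nat.
  rewrite normrM normr_nat; apply: le_lt_trans (ler_wpM2l _ (wd i)) _ => //.
  by rewrite ltr_pdivrMr// mul1r ltr_nat -addnn -{1}[N]addn0 ltn_add2l.
by rewrite -(ltr_nat R) natr_absz intr_norm.
Qed.

Lemma tile_bounds k d v y (p : V * Y) i : tile k d v y p ->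
  `|(MA ^+ k *m p.1 - v) i 0| <= d.
Proof.
move=> [/(_ i) + _]; rewrite !mxE => /andP[h1 h2].
by rewrite ger0_norm ?subr_ge0// lerBlDl.
Qed.

Section Separated.
Variable d : R.
Hypothesis hd : forall w : 'cV[rat]_n.+1,
  Zpoly (mxA A) w -> Zpoly (mxB A) w -> (forall i, `|ratr (w i 0)| <= d) -> w = 0.

Lemma level_mxB_pow k x : level (mxB A) k%:Z (mxB A ^+ k *m x) <-> Zpoly (mxB A) x.
Proof.
rewrite -level0E -[X in level _ X (_ *m _)](addr0 k%:Z) -[mxB A ^+ k]/(mxB A ^ k%:Z).
exact: level_mulE.
Qed.

Lemma Zlaurent_powB k x : Zlaurent (mxB A) x -> Zlaurent (mxB A) (mxB A ^+ k *m x).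
Proof. exact: (Zlaurent_mul uB k%:Z). Qed.

(** A common point bounds the real coordinates of [x - x'] by [d] and, by the ultrametric
    inequality, puts [mxB A ^+ k *m (x - x')] in level [k], that is [x - x'] in [Z^n[B]]; separation
    then applies. *)
Lemma tile_disjoint k x x' (p : V * Y) :
  Zlaurent (mxB A) x -> Zlaurent (mxB A) x' -> Zpoly (mxA A) (x - x') ->
  tile k d (toR x) (Zemb R A (mxB A ^+ k *m x)) p ->
  tile k d (toR x') (Zemb R A (mxB A ^+ k *m x')) p -> x = x'.
Proof.
move=> hx hx' hA [h1 h2] [h1' h2']; apply/eqP; rewrite -subr_eq0; apply/eqP.
apply: hd => // [|i].
  apply/(level_mxB_pow k); rewrite mulmxBr.
  have hl := Zlaurent_powB k hx; have hl' := Zlaurent_powB k hx'.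
  apply: (iffLR (Yball_emb R k%:Z (ZlaurentB uB hl hl'))); rewrite (ZembB R hl hl').
  have -> : forall y y' : Y, y - y' = (p.2 - y') - (p.2 - y).
    by move=> y y'; rewrite opprB [RHS]addrC subrKA.
  exact: (@YballB R n A k%:Z _ _ h2' h2).
have := h1 i; have := h1' i; rewrite !mxE rmorphB /= ler_norml => /andP[a1 a2] /andP[a3 a4].
apply/andP; split.
  by rewrite lerNl opprB lerBlDl (le_trans a1)//  addrC -lerBlDr opprK.
by rewrite lerBlDl (le_trans a3).
Qed.

End Separated.

End Tiles.

(** * Measure of the tiles *)

Section TileMeasure.
Variables (R : realType) (n : nat) (A : base n).
Local Notation V := 'cV[R]_n.+1.
Local Notation Y := (Zcompl R A).
Local Notation toR := (map_mx (ratr : rat -> R)).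
Local Notation MA := (map_mx (ratr : rat -> R) (mxA A) : 'M[R]_n.+1).
Local Notation MB := (map_mx (ratr : rat -> R) (mxB A) : 'M[R]_n.+1).
Local Notation a := (quot_card (mxA A)).

Let uA : mxA A \is a GRing.unit := expanding_unit (@base_expanding n A).
Let uB : mxB A \is a GRing.unit := mxB_unit A.

Lemma powBA k (x : 'cV[rat]_n.+1) : mxB A ^+ k *m (mxA A ^+ k *m x) = x.
Proof. by rewrite mulmxA mulmxE exprVn mulVr ?mul1mx// unitrX. Qed.

Lemma powAB k (x : 'cV[rat]_n.+1) : mxA A ^+ k *m (mxB A ^+ k *m x) = x.
Proof. by rewrite mulmxA mulmxE exprVn divrr ?mul1mx// unitrX. Qed.

Lemma Zlaurent_A x : Zpoly (mxA A) x -> Zlaurent (mxB A) x.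
Proof. by move=> hx; apply: Zlaurent_ZpolyV => //; rewrite invrK. Qed.

(** This is the explicit form of the compactness of [K_A / G]: remove the part in [Z^n[A]], then the
    integer part of the rest, which belongs to both modules. *)
Lemma Zlaurent_reduce (x : 'cV[rat]_n.+1) : Zlaurent (mxB A) x -> exists g,
  [/\ Zpoly (mxA A) g, Zpoly (mxB A) (x - g) & forall i, 0 <= (x - g) i 0 < 1].
Proof.
move=> /(Zlaurent_decomp uB)[g [y [hg hy ->]]]; rewrite invrK in hg.
pose z : 'cV[int]_n.+1 := \col_i Num.floor (y i 0).
have E : g + y - (g + zvec z) = y - zvec z by rewrite opprD addrACA subrr add0r.
exists (g + zvec z); rewrite E; split.
- by apply: ZpolyD => //; exact: Zpoly_zvec.
- by apply: ZpolyB => //; exact: Zpoly_zvec.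
- move=> i; rewrite !mxE subr_ge0 ltrBlDl.
  by have /andP[-> h] := floor_itv (y i 0); rewrite -intrD1 // addrC in h *.
Qed.

Lemma tile_point k (v x : V) : x = MB ^+ k *m (MA ^+ k *m x - v) + MB ^+ k *m v.
Proof. by rewrite mulmxBr subrK (MB_MA (@base_expanding n A)). Qed.

Variable lam : {measure set (borel V) -> \bar R}.
Hypothesis hlam : is_lebesgue lam.
Variable muB : {measure set (borel Y) -> \bar R}.
Hypothesis hmuB : is_haar muB.
Hypothesis hmuB1 : muB (@Zintegral R n A) = 1%E.
Local Notation mu := (muA lam hmuB hmuB1).
Local Notation tm k d := (mu (tile k d (0%R : V) (0%R : Y))).

Lemma muA_box_lty (v w : V) y : (mu (cbox v w `*` Ycoset 0 y) < +oo)%E.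
Proof.
rewrite muA_rect ?haar_Ycoset1 ?mule1; first exact: lebesgue_cbox_lty.
- exact: hmuB.
- exact: hmuB1.
- by apply: borel_closed; exact: closed_cbox.
- exact: measurable_Ycoset.
Qed.

Lemma measurable_box (v w : V) (y : Y) :
  measurable (cbox v w `*` Ycoset 0 y : set (borel V * borel Y)).
Proof.
apply: measurableX; last exact: measurable_Ycoset.
by apply: borel_closed; exact: closed_cbox.
Qed.

Section Residues.
Variable r : 'I_a -> 'cV[rat]_n.+1.
Hypothesis rM : forall i, Zpoly (mxA A) (r i).
Hypothesis r_surj : forall x, Zpoly (mxA A) x ->
  exists i y, Zpoly (mxA A) y /\ x = r i + mxA A *m y.
Hypothesis r_inj : forall i j y, Zpoly (mxA A) y -> r i = r j + mxA A *m y -> i = j.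

(** Representatives of [A^-k Z^n[A]] modulo [Z^n[A]], moved into a fixed bounded region so that the
    tiles placed at them can be compared with one box. *)
Lemma residue_points k : exists s : {ffun 'I_k -> 'I_a} -> 'cV[rat]_n.+1,
  [/\ forall e, Zpoly (mxB A) (s e), forall e i, 0 <= (s e) i 0 < 1 &
  forall e, exists2 g, Zpoly (mxA A) g & s e = mxB A ^+ k *m digit_sum (mxA A) r e - g].
Proof.
have /choice[s hs] : forall e : {ffun 'I_k -> 'I_a}, exists s, [/\ Zpoly (mxB A) s,
    forall i, 0 <= s i 0 < 1 &
    exists2 g, Zpoly (mxA A) g & s = mxB A ^+ k *m digit_sum (mxA A) r e - g].
  move=> e.
  have hl : Zlaurent (mxB A) (mxB A ^+ k *m digit_sum (mxA A) r e).
    by apply: Zlaurent_powB; apply: Zlaurent_A; exact: digit_sum_Zpoly.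
  have [g [hg h1 h2]] := Zlaurent_reduce hl.
  by eexists; split; [exact: h1|exact: h2|exists g].
by exists s; split=> e; have [] := hs e.
Qed.

(* The [a ^ k] tiles at pairwise incongruent points of [A^-k Z^n[A]] are
   disjoint and stay in a fixed bounded set. *)
Lemma tile_upper_bound (d : R) : 0 < d -> (forall w : 'cV[rat]_n.+1,
    Zpoly (mxA A) w -> Zpoly (mxB A) w -> (forall i, `|ratr (w i 0)| <= d) -> w = 0) ->
  exists C : R, forall k, (((a ^ k)%N%:R)%:E * tm k d <= C%:E)%E.
Proof.
move=> d0 hd; have [K K0 hK] := inv_power_bounded R (@base_expanding n A).
(* Tiles sit at points [s e] of the unit cube, and [A^-k] stretches a cube of side [d] to at most
   [K * d] in each coordinate, uniformly in [k]. *)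
pose Q : set (borel V * borel Y) :=
  cbox (const_mx (- (K * d))) (const_mx (1 + K * d)) `*` Ycoset 0 (0 : Y).
have Qfin : mu Q \is a fin_num by rewrite ge0_fin_numE//; exact: muA_box_lty.
exists (fine (mu Q)) => k; rewrite fineK//.
have [s [sB s01 sE]] := residue_points k.
pose X e := mxA A ^+ k *m s e.
have BX e : mxB A ^+ k *m X e = s e by rewrite powBA.
pose F e := tile k d (toR (X e)) (Zemb R A (mxB A ^+ k *m X e)).
have XL e : Zlaurent (mxB A) (X e).
  by apply: Zlaurent_powA; exact: Zlaurent_Zpoly.
have XE e : exists2 g, Zpoly (mxA A) g &
    X e = digit_sum (mxA A) r e - mxA A ^+ k *m g.
  by have [g hg gE] := sE e; exists g => //; rewrite /X gE mulmxBr powAB.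
have := @measure_disjoint_union _ _ _ mu _ F (tm k d).
rewrite card_ffun !card_ord => <-.
- apply: le_measure; rewrite ?inE.
  + apply: fin_bigcup_measurable; first exact: finite_finset.
    by move=> e _; exact: measurable_tile.
  + exact: measurable_box.
  move=> p [e _ pF]; split; last first.
    rewrite /Ycoset /= subr0; case: pF => _; rewrite BX => h.
    rewrite -(subrK (Zemb R A (s e)) p.2); apply: YballD.
      by apply: Yball_le h.
    apply/Yball_emb; first exact: Zlaurent_Zpoly.
    by apply/level0E.
  move=> i; rewrite !mxE.
  have := hK k _ _ (fun j => tile_bounds j pF) i; rewrite ler_norml => /andP[h1 h2].
  rewrite (tile_point k (toR (X e)) p.1) ratr_mulmx BX mxE [X in _ + X]mxE.
  have /andP[h3 h4] := s01 e i.
  rewrite -[leLHS]addr0 lerD//= ?ler0q//  addrC lerD//.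
  by rewrite -(rmorph1 (ratr : rat -> R)) ler_rat ltW.
- by move=> e; exact: measurable_tile.
- by move=> e; exact: muA_tile.
move=> e e' p pe pe'.
have [g hg gE] := XE e; have [g' hg' gE'] := XE e'.
have XX : X e = X e'.
  apply: (tile_disjoint hd (XL e) (XL e') _ pe pe').
  rewrite gE gE'; apply: ZpolyB; apply: ZpolyB;
    by [exact: digit_sum_Zpoly|exact: Zpoly_exp].
apply: (residue_sum_inj uA rM r_inj (ZpolyB hg hg')).
by rewrite mulmxBr addrCA -gE' -XX gE addrC subrK.
Qed.

(* The tiles at the points of [A^-k Z^n[A]] cover the whole space, and a bounded
   set only meets boundedly many of them per residue. *)
Lemma unit_tile_lower_bound :
  exists G : nat, forall k, (1 <= ((a ^ k * G)%N%:R)%:E * tm k 1%R)%E.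
Proof.
have [K K0 hK] := inv_power_bounded R (@base_expanding n A).
have [N N0 hN] := Zpoly_inter_denom uA.
(* Bounds the coordinates of [N (t - s e)] below: [t] will be within [K] of [p.1], while [p.1] and
   [s e] lie in the unit cube. As that vector is integral, [w] enumerates all candidates for
   [t - s e]. *)
pose L := Num.bound (N%:R * (1 + K + 1) : R).
have hL : N%:R * (1 + K + 1) <= L%:R :> R.
  by rewrite ltW// archi_boundP// mulr_ge0// !addr_ge0.
exists ((L.*2.+1 ^ n.+1)%N) => k.
have [s [sB s01 sE]] := residue_points k.
pose w (c : 'cV['I_(L.*2.+1)]_n.+1) : 'cV[rat]_n.+1 :=
  N%:R^-1 *: zvec (map_mx (fun i : 'I_(L.*2.+1) => i%:Z - L%:Z) c).
pose I : finType := ({ffun 'I_k -> 'I_a} * 'cV['I_(L.*2.+1)]_n.+1)%type.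
pose pt (j : I) := s j.1 + w j.2.
pose F (j : I) := tile k 1 (toR (mxA A ^+ k *m pt j)) (Zemb R A (pt j)).
pose Q : set (borel V * borel Y) := cbox (const_mx 0) (const_mx 1) `*` Ycoset 0 (0 : Y).
have mQ : mu Q = 1%E.
  rewrite muA_rect; [|by apply: borel_closed; exact: closed_cbox|exact: measurable_Ycoset].
  rewrite (haar_Ycoset1 hmuB hmuB1) mule1 hlam => [|i]; last by rewrite !mxE.
  by rewrite big1// => i _; rewrite !mxE subr0.
have cardI : #|{: I}| = (a ^ k * L.*2.+1 ^ n.+1)%N.
  by rewrite card_prod card_ffun card_mx !card_ord muln1.
rewrite -cardI -mQ; apply: (measure_cover_le (F := F)).
- exact: measurable_box.
- by move=> j; exact: measurable_tile.
- by move=> j; rewrite [leLHS]muA_tile.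
move=> p [pQ1 pQ2].
have {}pQ2 : Yball 0 p.2 by have := pQ2; rewrite /Ycoset /= subr0.
have [x hx px] := Zemb_dense k p.2.
have [g [y [hg hy xE]]] := Zlaurent_decomp uB (Zlaurent_powA k hx).
rewrite invrK in hg.
have [u uE] : exists u : V, u = MA ^+ k *m p.1 by eexists.
(* Rounding places [A^k p.1] in the unit cube at [X]. Since [z] is integral, [X] stays in [Z^n[A]]
   and the error [y - z] stays in [Z^n[B]]. *)
pose z : 'cV[int]_n.+1 := \col_i Num.floor (u i 0 - toR g i 0).
pose X := g + zvec z; pose t := mxB A ^+ k *m X.
have hX : Zpoly (mxA A) X by apply: ZpolyD => //; exact: Zpoly_zvec.
have tL : Zlaurent (mxB A) t by apply: Zlaurent_powB; exact: Zlaurent_A.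
have pt2 : Yball k (p.2 - Zemb R A t).
  rewrite -(subrKA (Zemb R A x) p.2); apply: (YballD px).
  rewrite -(ZembB R hx tL); apply: (iffRL (Yball_emb R k (ZlaurentB uB hx tL))).
  have -> : x - t = mxB A ^+ k *m (y - zvec z).
    rewrite -[x](powBA k) xE -mulmxBr /X opprD addrACA subrr add0r//.
  by apply/level_mxB_pow; apply: ZpolyB => //; exact: Zpoly_zvec.
have uX i : 0 <= u i 0 - toR X i 0 <= 1.
  have -> : toR X i 0 = toR g i 0 + (z i 0)%:~R.
    by rewrite /X [LHS]mxE [(g + _) i 0]mxE [zvec z i 0]mxE rmorphD /= ratr_int [toR g i 0]mxE.
  have zE : z i 0 = Num.floor (u i 0 - toR g i 0) by rewrite !mxE.
  have := floor_itv (u i 0 - toR g i 0); rewrite -zE intrD => /andP[].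
  by move: (toR g i 0) (u i 0) ((z i 0)%:~R) => ? ? ? ? ?; apply/andP; split; lra.
have pt1 : cbox (toR X) (toR X + const_mx 1) u.
  by move=> i; rewrite [(toR X + _) i 0]mxE [const_mx _ _ _]mxE; have /andP[? ?] := uX i; lra.
have tB : Zpoly (mxB A) t.
  apply/level0E; apply/(Yball_emb R 0 tL).
  rewrite -(subKr p.2 (Zemb R A t)); apply: YballB => //.
  exact: Yball_le pt2.
(* [e] is the residue word of [X], so [t] and [s e] agree modulo [Z^n[A]]; both lie in [Z^n[B]],
   which leaves finitely many differences. *)
have [e [g' [hg' XE]]] := residue_sum_surj r_surj k hX.
have [ge hge seE] := sE e.
have dE : t - s e = ge + g'.
  by rewrite seE /t XE mulmxDr powBA opprB [LHS]addrC subrKA.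
have dA : Zpoly (mxA A) (t - s e) by rewrite dE; exact: ZpolyD.
have dB : Zpoly (mxB A) (t - s e) by exact: ZpolyB.
have [q hq] := hN _ dA dB.
have tb i : `|ratr ((t - s e) i 0)| <= 1 + K + 1 :> R.
  have bX j : `|(u - toR X) j 0| <= 1.
    by rewrite [(u - _) j 0]mxE [(- toR X) j 0]mxE; have /andP[h1 h2] := uX j; rewrite ger0_norm.
  have := hK k _ _ bX i; rewrite mulr1 ler_norml => /andP[h1 h2].
  have := tile_point k (toR X) p.1; rewrite ratr_mulmx -/t -uE => /matrixP/(_ i 0).
  rewrite [RHS]mxE [toR t _ _]mxE => pE.
  have := pQ1 i; rewrite ![const_mx _ _ _]mxE pE => /andP[h3 h4].
  have /andP[] := s01 e i; rewrite -(ler_rat R) -(ltr_rat R) rmorph0 rmorph1 => h5 h6.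
  rewrite [(t - _) i 0]mxE [(- s e) i 0]mxE rmorphB /= ler_norml.
  move: h1 h2 h3 h4 h5 h6; move: (ratr (t i 0)) (ratr (s e i 0)) (_ i 0) => ? ? ?.
  by move=> *; apply/andP; split; lra.
have qL i : `|q i 0| <= L%:Z.
  rewrite -(ler_int R) intr_norm; apply: le_trans hL.
  have -> : (q i 0)%:~R = N%:R * ratr ((t - s e) i 0) :> R.
    have /matrixP/(_ i 0) := hq; rewrite [LHS]mxE [RHS]mxE => qE.
    by rewrite -(ratr_int _ (q i 0)) -qE rmorphM /= ratr_nat.
  by rewrite normrM normr_nat ler_wpM2l.
pose c : 'cV['I_(L.*2.+1)]_n.+1 := \col_i inord (absz (q i 0 + L%:Z)).
have cE : pt (e, c) = t.
  rewrite /pt /w /=.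
  have -> : map_mx (fun i : 'I_(L.*2.+1) => i%:Z - L%:Z) c = q.
    apply/matrixP => i j; rewrite ord1 !mxE; have := qL i; rewrite ler_norml => /andP[h1 h2].
    have h0 : 0 <= q i 0 + L%:Z by rewrite -lerBlDr sub0r.
    rewrite inordK; first by rewrite abszE ger0_norm// addrK.
    rewrite ltnS -lez_nat abszE ger0_norm// -addnn PoszD lerD2r//.
  by rewrite -hq scalerA mulVf ?scale1r ?subrKC// pnatr_eq0 -lt0n.
have mem : F (e, c) p.
  split; last by rewrite /Ycoset /= cE.
  by rewrite /= cE powAB -uE.
by exists (e, c); [exact: Logic.I|exact: mem].
Qed.

End Residues.

(** Links the covering cube to the separating one: the unit cube is cut into cubes of side [d]
    before [A^-k] is applied, so their number is independent of [k]. *)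
Lemma tile_refine (d : R) : 0 < d ->
  exists J : nat, forall k, (tm k 1%R <= (J%:R)%:E * tm k d)%E.
Proof.
move=> d0; pose J := (Num.bound d^-1).+1.
exists (J ^ n.+1)%N => k.
pose I : finType := {ffun 'I_n.+1 -> 'I_J}.
pose F (e : I) := tile k d (\col_i (d * (e i)%:R)) (0 : Y).
have cardI : #|{: I}| = (J ^ n.+1)%N by rewrite card_ffun !card_ord.
rewrite -cardI; apply: (measure_cover_le (F := F)).
- exact: measurable_tile.
- by move=> e; exact: measurable_tile.
- by move=> e; rewrite [leLHS]muA_tile.
move=> p [p1 p2]; have [u uE] : exists u : V, u = MA ^+ k *m p.1 by eexists.
have u01 i : 0 <= u i 0 <= 1 by have := p1 i; rewrite -uE !mxE add0r.
have ud i : 0 <= u i 0 / d by have /andP[h _] := u01 i; exact: divr_ge0 h (ltW d0).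
have uJ i : (Num.truncn (u i ord0 / d)%R < J)%N.
  rewrite /J ltnS -(ler_nat R); have /andP[h _] := truncn_itv (ud i).
  apply: (le_trans h); rewrite ltW//; apply: le_lt_trans (archi_boundP _); last first.
    by rewrite invr_ge0 ltW.
  by have /andP[_ h1] := u01 i; rewrite ler_piMl// invr_ge0 ltW.
pose e : I := [ffun i => Ordinal (uJ i)].
have mem : F e p.
  split=> // i; rewrite /= -uE [(_ + const_mx d) i 0]mxE ![(\col__ _) i 0]mxE [const_mx _ _ _]mxE.
  rewrite ffunE /=; have /andP[h1 h2] := truncn_itv (ud i).
  rewrite ler_pdivlMr// in h1; rewrite ltr_pdivrMr// in h2.
  by rewrite mulrC h1 /= ltW// (lt_le_trans h2)// -natr1 mulrDl mul1r.
by exists e; [exact: Logic.I|exact: mem].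
Qed.

Lemma tile_measure_bounds : exists d C c : R, [/\ 0 < d,
  forall w : 'cV[rat]_n.+1, Zpoly (mxA A) w -> Zpoly (mxB A) w ->
    (forall i, `|ratr (w i 0)| <= d) -> w = 0,
  0 < c &
  forall k, exists2 T : R, tm k d = T%:E & c <= (a ^ k)%N%:R * T <= C].
Proof.
have [d d0 hd] := lattice_separation R A.
have [r [rM r_surj r_inj]] := residues_exist uA.
have [C hC] := tile_upper_bound rM r_inj d0 hd.
have [G hG] := unit_tile_lower_bound rM r_surj.
have [J hJ] := tile_refine d0.
have a0 : (0 < a)%N by have [[i lt_ia] _] := r_surj 0 (Zpoly0 _); exact: leq_ltn_trans lt_ia.
have fin k : exists T : R, tm k d = T%:E.
  have := hC k; have : (0 <= tm k d)%E by exact: measure_ge0.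
  case: (tm k d) => [T _ _| _|]; [by exists T| |by []].
  by rewrite gt0_muley ?leye_eq// lte_fin ltr0n expn_gt0 a0.
have lower k T : tm k d = T%:E -> 1 <= (G * J)%N%:R * ((a ^ k)%N%:R * T).
  move=> TE; have := hJ k; rewrite TE -EFinM => h.
  have := hG k; have : (0 <= tm k 1%R)%E by exact: measure_ge0.
  case: (tm k 1%R) h => [S| |]; [|by rewrite leye_eq|by []].
  rewrite -EFinM !lee_fin => h _ /le_trans; apply.
  apply: (le_trans (ler_wpM2l _ h)); first by [].
  by rewrite le_eqVlt; apply/orP; left; apply/eqP; rewrite !natrM; ring.
have GJ0 : (0 < G * J)%N.
  have [T /lower] := fin 0%N; case: (G * J)%N => //.
  by rewrite mul0r ler10.
exists d, C, ((G * J)%N%:R)^-1; split => //; first by rewrite invr_gt0 ltr0n.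
move=> k; have [T TE] := fin k; exists T => //; apply/andP; split.
  by rewrite -[_^-1]mul1r ler_pdivrMr ?ltr0n// mulrC; exact: lower.
by have := hC k; rewrite TE -EFinM lee_fin.
Qed.

End TileMeasure.

(** * The attractor *)

Section Attractor.
Variables (R : realType) (n : nat) (A : base n) (D : {fset 'cV[rat]_n.+1}).
Local Notation V := 'cV[R]_n.+1.
Local Notation Y := (Zcompl R A).
Local Notation MA := (map_mx (ratr : rat -> R) (mxA A) : 'M[R]_n.+1).
Local Notation mulA := (@KA_mulA R n A).
Local Notation mulY := (@Zcompl_mulA R n A).

Lemma iter_KA k (p : KA R A) : iter k mulA p = (MA ^+ k *m p.1, iter k mulY p.2).
Proof.
elim: k => [|k ih]; first by rewrite expr0 mul1mx; case: p.
by rewrite iterS ih /KA_mulA /= mulmxA exprS.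
Qed.

Lemma phiD x y : Zlaurent (mxB A) x -> Zlaurent (mxB A) y ->
  phi R A (x + y) = phi R A x + phi R A y.
Proof. by move=> hx hy; rewrite /phi (ZembD R hx hy) map_mxD. Qed.

Lemma mulA_D p q : mulA (p + q) = mulA p + mulA q.
Proof.
rewrite /KA_mulA /= mulmxDr; congr (_, _).
by have := Zcompl_mulAB (p.2 + q.2) q.2; rewrite addrK => ->; rewrite subrK.
Qed.

Lemma mulA_phi x : Zlaurent (mxB A) x -> mulA (phi R A x) = phi R A (mxA A *m x).
Proof. by move=> hx; rewrite /KA_mulA /phi /= Zcompl_mulA_emb// map_mxM. Qed.

Lemma iter_mulA_D k p q : iter k mulA (p + q) = iter k mulA p + iter k mulA q.
Proof. by elim: k => // k ih; rewrite !iterS ih mulA_D. Qed.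

Lemma iter_mulA_phi k x : Zlaurent (mxB A) x ->
  iter k mulA (phi R A x) = phi R A (mxA A ^+ k *m x).
Proof.
move=> hx; elim: k => [|k ih]; first by rewrite expr0 mul1mx.
rewrite iterS ih mulA_phi; last exact: Zlaurent_powA.
by rewrite exprS mulmxA.
Qed.

Hypothesis hDA : [set` D] `<=` Zpoly (mxA A).
Variable F : set (KA R A).
Hypothesis hF : digit_tile D F.

Local Notation expn := (@expansion n (mxA A) D).

Lemma digit_Zpoly (c : D) : Zpoly (mxA A) (val c).
Proof. by apply: hDA; exact: valP. Qed.

Lemma expansion_Zpoly k (d : {ffun 'I_k -> D}) : Zpoly (mxA A) (expn d).
Proof. by apply: (@digit_sum_Zpoly n (mxA A) D val k d); exact: digit_Zpoly. Qed.

Lemma expansion_Zlaurent k (d : {ffun 'I_k -> D}) : Zlaurent (mxB A) (expn d).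
Proof. by apply: Zlaurent_A; exact: expansion_Zpoly. Qed.

Lemma phi_expansion_cons k (c : D) (d : {ffun 'I_k -> D}) :
  phi R A (expn (dcons c d)) = phi R A (val c) + mulA (phi R A (expn d)).
Proof.
have hc : Zlaurent (mxB A) (val c) by apply: Zlaurent_A; exact: digit_Zpoly.
rewrite (mulA_phi (expansion_Zlaurent d)) -phiD//; last first.
  by apply: Zlaurent_mulA; exact: expansion_Zlaurent.
by congr (phi _ _ _); exact: (@digit_sum_cons n (mxA A) D val k c d).
Qed.

Lemma attractor_forward k p : F p -> exists (d : {ffun 'I_k -> D}) f,
  F f /\ iter k mulA p = f + phi R A (expn d).
Proof.
have [_ _ hE] := hF; move=> Fp; elim: k => [|k [d [f [Ff E]]]].
  exists (ffun0 (card_ord 0)), p; split => //.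
  rewrite [expn _](digit_sum0 (mxA A) val) /phi map_mx0 Zemb0.
  by rewrite -[X in _ = _ + X]/(0 : KA R A) addr0.
have : (mulA @` F) (mulA f) by exists f.
rewrite hE => -[c /= cD [g Fg gE]].
exists (dcons [` cD]%fset d), g; split => //.
rewrite E mulA_D -gE phi_expansion_cons addrA; congr (_ + _).
Qed.

Lemma attractor_backward k (d : {ffun 'I_k -> D}) f : F f ->
  exists2 p, F p & iter k mulA p = f + phi R A (expn d).
Proof.
have [_ _ hE] := hF; elim: k d f => [|k ih] d f Ff.
  exists f => //; rewrite [expn _](digit_sum0 (mxA A) val) /phi map_mx0 Zemb0.
  by rewrite -[X in _ = _ + X]/(0 : KA R A) addr0.
have : (\bigcup_(d in [set` D]) [set p + phi R A d | p in F]) (f + phi R A (val (d ord0))).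
  by exists (val (d ord0)); [exact: valP|exists f].
rewrite -hE => -[g Fg gE]; have [p Fp pE] := ih (dtail d) g Fg.
exists p => //; rewrite iterS pE mulA_D gE -addrA -phi_expansion_cons.
by rewrite dconsK.
Qed.

Lemma KA_hausdorff : hausdorff_space (V * Y)%type.
Proof.
move=> [p1 p2] [q1 q2] pq; congr (_, _).
  apply: (@norm_hausdorff R V) => S T pS qT.
  have [||[x y] [/= Sx Tx]] := pq (fst @^-1` S) (fst @^-1` T).
  - by apply: (@cvg_fst _ _ (nbhs p1) (nbhs p2)).
  - by apply: (@cvg_fst _ _ (nbhs q1) (nbhs q2)).
  by exists x.
apply: (@metric_hausdorff R Y) => S T pS qT.
have [||[x y] [/= Sx Tx]] := pq (snd @^-1` S) (snd @^-1` T).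
- by apply: (@cvg_snd _ _ (nbhs p1) (nbhs p2)).
- by apply: (@cvg_snd _ _ (nbhs q1) (nbhs q2)).
by exists y.
Qed.

Lemma attractor_closed : closed (F : set (V * Y)).
Proof. by have [_ cF _] := hF; apply: compact_closed cF; exact: KA_hausdorff. Qed.

(** The centres in the second factor are chosen in [Z^n(B)], where [A^-k] acts by a matrix; on the
    completion only multiplication by [A] is defined. *)
Lemma attractor_cover (d : R) : 0 < d ->
  exists (J : finType) (v : J -> V) (s : J -> 'cV[rat]_n.+1),
  (forall j, Zlaurent (mxB A) (s j)) /\
  forall p, F p -> exists j, tile 0 d (v j) (Zemb R A (s j)) p.
Proof.
move=> d0; have cF : @compact (V * Y)%type F by have [] := hF.
pose T : ptopologicalType := HB.pack_for ptopologicalType (V * Y)%type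
  (isPointed.Build (V * Y)%type (0, 0)).
have {}cF : @cover_compact T F by rewrite -compact_cover.
have d2 : 0 < d / 2 by rewrite divr_gt0.
have /choice[s hs] : forall p : V * Y, exists s, Zlaurent (mxB A) s /\
    Yball 0 (p.2 - Zemb R A s).
  by move=> p; have [s hs ps] := Zemb_dense 0 p.2; exists s.
pose U (p : V * Y) : set (V * Y) := (ball p.1 (d / 2))° `*` Ycoset 0 (Zemb R A (s p)).
have [||J _ FJ] := cF _ (F : set (V * Y)) U.
- move=> p _; rewrite (_ : U p = fst @^-1` (ball p.1 (d / 2))° `&`
      snd @^-1` Ycoset 0 (Zemb R A (s p))); last by [].
  apply: openI; apply: open_comp => [q _|].
  + exact: cvg_fst.
  + exact: open_interior.
  + exact: cvg_snd.
  + exact: open_Yball.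
- move=> p Fp; exists p => //; split; last by have [] := hs p.
  by apply: nbhsx_ballx.
exists J, (fun p : J => (val p).1 - const_mx (d / 2)), (fun p : J => s (val p)).
split=> [p|p /FJ[q qJ [/interior_subset[_ q1] q2]]]; first by have [] := hs (val p).
exists [` qJ]%fset; split=> //= i; rewrite expr0 mul1mx !mxE.
have := q1 i 0; rewrite /ball /= ltr_distlC => /andP[h1 h2].
by apply/andP; split; lra.
Qed.

End Attractor.

Lemma geometric_small (R : realType) (c t e : R) : 0 <= t -> t < 1 -> 0 < e ->
  exists N, forall k, (N <= k)%N -> c * t ^+ k < e.
Proof.
move=> t0 t1 e0.
have : geometric c t @ \oo --> (0 : R) by apply: cvg_geometric; rewrite ger0_norm.
move/cvgr_lt => /(_ _ e0) [N _ hN]; exists N => k Nk.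
exact: hN.
Qed.

Lemma subr_addKA (Z : zmodType) (x y z w : Z) :
  x - (y + z) = (x - (w + z)) + (w - y).
Proof. by rewrite -addrA opprD [- (w + z)]opprD addrACA addNr add0r [- z - y]addrC. Qed.

(** * Finite-level tile covers of the attractor and their upper limit *)

Section AttractorLevels.
Variables (R : realType) (n : nat) (A : base n) (D : {fset 'cV[rat]_n.+1}).
Local Notation V := 'cV[R]_n.+1.
Local Notation Y := (Zcompl R A).
Local Notation toR := (map_mx (ratr : rat -> R)).
Local Notation MA := (map_mx (ratr : rat -> R) (mxA A) : 'M[R]_n.+1).
Local Notation mulA := (@KA_mulA R n A).
Local Notation mulY := (@Zcompl_mulA R n A).
Local Notation expn := (@expansion n (mxA A) D).

Let uB : mxB A \is a GRing.unit := mxB_unit A.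

Hypothesis hDA : [set` D] `<=` Zpoly (mxA A).
Variable F : set (KA R A).
Hypothesis hF : digit_tile D F.
Variable d : R.

Lemma Yball_iter_coset k x (y : Y) : Zlaurent (mxB A) x ->
  Yball k%:Z (y - Zemb R A (mxB A ^+ k *m x)) <-> Yball 0 (iter k mulY y - Zemb R A x).
Proof.
move=> hx; rewrite -[k%:Z]add0r -Yball_iter_mulA iter_mulAB.
by rewrite (iter_mulA_emb R k (Zlaurent_powB k hx)) powAB.
Qed.

Section Levels.
Variables (J : finType) (v : J -> V) (s : J -> 'cV[rat]_n.+1).
Hypothesis hs : forall j, Zlaurent (mxB A) (s j).

(** The set [A^-k (U_j + phi x)], where [U_j] is the tile of level 0 at [(v j, s j)]. *)
Definition digit_tile_at k x j : set (borel V * borel Y) :=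
  tile k d (v j + toR x) (Zemb R A (mxB A ^+ k *m (s j + x))).

Definition tile_level k : set (borel V * borel Y) :=
  \bigcup_(q in [set: {ffun 'I_k -> D} * J]) digit_tile_at k (expn q.1) q.2.

Lemma measurable_tile_level k : measurable (tile_level k).
Proof.
apply: fin_bigcup_measurable; first exact: finite_finset.
by move=> q _; exact: measurable_tile.
Qed.

(** The translations form an arbitrary finite family because a coincidence among expansions lets
    fewer than [a ^ k] of them suffice. *)
Lemma attractor_sub_tiles k (T : finType) (x : T -> 'cV[rat]_n.+1) :
  (forall p, F p -> exists j, tile 0 d (v j) (Zemb R A (s j)) p) ->
  (forall i, Zlaurent (mxB A) (x i)) ->
  (forall p, F p -> exists i f, F f /\ iter k mulA p = f + phi R A (x i)) ->
  F `<=` \bigcup_(q in [set: T * J]) digit_tile_at k (x q.1) q.2.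
Proof.
move=> cov xL hx p Fp; have [e [f [Ff pE]]] := hx p Fp.
have [j [f1 f2]] := cov f Ff.
move: pE; rewrite iter_KA => -[p1E p2E].
exists (e, j); first exact: Logic.I.
split.
  move=> i; have := f1 i; rewrite expr0 mul1mx /= p1E.
  by rewrite !mxE => /andP[h1 h2]; apply/andP; split; lra.
apply/(Yball_iter_coset k _ (ZlaurentD uB (hs j) (xL e))).
by rewrite /= p2E (ZembD R (hs j) (xL e)) opprD addrACA subrr addr0.
Qed.

Lemma attractor_sub_level k :
  (forall p, F p -> exists j, tile 0 d (v j) (Zemb R A (s j)) p) ->
  F `<=` tile_level k.
Proof.
move=> cov; apply: (attractor_sub_tiles cov) => [e|p].
  exact: expansion_Zlaurent.
exact: attractor_forward.
Qed.

(** The nearby point [g] has the same leading digits as the tile, continued by a fixed [f0] in [F].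
    After applying [A^k] only the offset between the tile of level 0 and [f0] remains; sums over the
    finite [J] bound it uniformly. *)
Lemma tile_level_near : exists (M : R) (j0 : int), j0 <= 0 /\
  forall k p, tile_level k p -> exists2 g, F g &
    (forall i, `|(MA ^+ k *m (p.1 - g.1)) i 0| <= M) /\ Yball (j0 + k%:Z) (p.2 - g.2).
Proof.
have [[f0 Ff0] _ _] := hF.
have /choice[l hl] : forall j, exists l, Yball l (Zemb R A (s j) - f0.2).
  by move=> j; exact: Yball_exhaust.
exists (d + \sum_j \sum_i `|(v j - f0.1) i 0|), (- (\sum_j `|l j|)); split.
  by rewrite oppr_le0 sumr_ge0.
move=> k p [[e j] _ pt]; have [g Fg gE] := attractor_backward hDA hF e Ff0.
have eL := expansion_Zlaurent hDA e.
move: gE; rewrite iter_KA => -[g1E g2E].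
exists g => //; split.
  move=> i; have := tile_bounds i pt; rewrite mulmxBr g1E /=.
  have -> : MA ^+ k *m p.1 - (f0.1 + toR (expn e)) =
      (MA ^+ k *m p.1 - (v j + toR (expn e))) + (v j - f0.1).
    exact: subr_addKA.
  rewrite [X in _ -> `|X| <= _]mxE => h; apply: le_trans (ler_normD _ _) _.
  apply: (lerD h); rewrite (bigD1 j)//= (bigD1 i)//= -addrA lerDl addr_ge0//.
    by rewrite sumr_ge0.
  by rewrite sumr_ge0// => j' _; rewrite sumr_ge0.
rewrite -Yball_iter_mulA iter_mulAB g2E.
case: pt => _ /(Yball_iter_coset k _ (ZlaurentD uB (hs j) eL)).
rewrite (ZembD R (hs j) eL) => h.
set z := iter k mulY p.2 in h *.
have -> : z - (f0.2 + Zemb R A (expn e)) =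
   (z - (Zemb R A (s j) + Zemb R A (expn e))) + (Zemb R A (s j) - f0.2).
  exact: subr_addKA.
apply: YballD.
  by apply: Yball_le h; rewrite oppr_le0 sumr_ge0.
apply: Yball_le (hl j); rewrite lerNl.
apply: (@le_trans _ _ `|l j|); first by rewrite -normrN ler_norm.
by rewrite (bigD1 j)//= lerDl sumr_ge0.
Qed.

(** [A^-k] contracts both factors, so a point lying in infinitely many levels is a limit of points
    of the closed set [F]. *)
Lemma lim_sup_level_sub : lim_sup_set tile_level `<=` F.
Proof.
move=> p ph; apply: (attractor_closed hF).
move=> W /nbhs_ballP[e /= e0 eW].
have [M [j0 [_ hM]]] := tile_level_near.
have [C [t [C0 t0 t1 hC]]] := inv_power_contraction R (@base_expanding n A).
have b1 := base_b_gt1 R A; have b0 := lt_trans ltr01 b1.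
have [N1 hN1] := geometric_small (C * M) t0 t1 e0.
have [||N2 hN2] := @geometric_small R ((base_b A)%:R ^ (- j0)) (base_b A)%:R^-1 e _ _ e0.
- by rewrite invr_ge0 ltW.
- by rewrite invf_lt1.
have [k /= Nk pk] := ph (maxn N1 N2) Logic.I.
have [g Fg [g1 g2]] := hM k p pk.
exists g; split => //; apply: eW; split.
  split=> // i j; rewrite ord1 /ball /= -[p.1 i 0 - _](_ : (p.1 - g.1) i 0 = _); last by rewrite !mxE.
  rewrite -[p.1 - g.1](MB_MA (@base_expanding n A) k).
  apply: le_lt_trans (hC k _ _ g1 i) _.
  by rewrite mulrAC hN1// (leq_trans (leq_maxl _ _) Nk).
rewrite ballEmdist /=; apply: (le_lt_trans (iffRL (Yball_mdist _ _ _) g2)).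
rewrite opprD expfzDr ?gt_eqF// -exprnN -exprVn hN2//.
exact: leq_trans (leq_maxr _ _) Nk.
Qed.

End Levels.
End AttractorLevels.

(** * Positive measure *)

Section PositiveMeasure.
Variables (R : realType) (n : nat) (A : base n) (D : {fset 'cV[rat]_n.+1}).
Local Notation V := 'cV[R]_n.+1.
Local Notation Y := (Zcompl R A).
Local Notation mulA := (@KA_mulA R n A).
Local Notation a := (quot_card (mxA A)).
Local Notation expn := (@expansion n (mxA A) D).

Let uB : mxB A \is a GRing.unit := mxB_unit A.

Variable lam : {measure set (borel V) -> \bar R}.
Hypothesis hlam : is_lebesgue lam.
Variable muB : {measure set (borel Y) -> \bar R}.
Hypothesis hmuB : is_haar muB.
Hypothesis hmuB1 : muB (@Zintegral R n A) = 1%E.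
Local Notation mu := (muA lam hmuB hmuB1).

Hypothesis hDA : [set` D] `<=` Zpoly (mxA A).
Hypothesis hDa : #|` D| = a.
Variable F : set (KA R A).
Hypothesis hF : digit_tile D F.

(** [F] lies in every level of a covering family, so it equals the upper limit of these finite
    unions of rectangles. *)
Lemma attractor_measurable : measurable (F : set (borel V * borel Y)).
Proof.
have [J [v [s [hs cov]]]] := attractor_cover hF (@ltr01 R).
rewrite (_ : (F : set (borel V * borel Y)) = lim_sup_set (tile_level D 1 v s)).
  apply: bigcap_measurable => // i _; apply: bigcup_measurable => j _.
  exact: measurable_tile_level.
apply/seteqP; split; last exact: lim_sup_level_sub.
move=> p Fp i _; exists i => /=; first exact: leqnn.
exact: (attractor_sub_level hDA hF hs i cov Fp).
Qed.

Lemma card_digit_words k : #|{ffun 'I_k -> D}| = (a ^ k)%N.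
Proof. by rewrite card_ffun card_ord -hDa cardfE. Qed.

(** Concatenating blocks of [k] digits multiplies the numbers of translations, so a saving in one
    block becomes exponential. *)
Lemma reach_iter k N : (exists (T : finType) (x : T -> 'cV[rat]_n.+1), [/\ #|T| = N,
    forall i, Zlaurent (mxB A) (x i) &
    forall p, F p -> exists i f, F f /\ iter k mulA p = f + phi R A (x i)]) ->
  forall m, exists (T : finType) (x : T -> 'cV[rat]_n.+1), [/\ #|T| = (N ^ m)%N,
    forall i, Zlaurent (mxB A) (x i) &
    forall p, F p -> exists i f, F f /\ iter (m * k) mulA p = f + phi R A (x i)].
Proof.
move=> [T [x [hT xL hx]]]; elim=> [|m [T' [x' [hT' xL' hx']]]].
  exists unit, (fun=> 0); split=> [|_|p Fp]; first by rewrite card_unit.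
    exact: Zlaurent0.
  exists tt, p; split => //; rewrite /phi map_mx0 Zemb0.
  by rewrite -[X in _ = _ + X]/(0 : KA R A) addr0.
exists (T * T')%type, (fun q => x q.1 + mxA A ^+ k *m x' q.2); split.
- by rewrite card_prod hT hT' expnS.
- by move=> q; apply: (ZlaurentD uB) => //; exact: Zlaurent_powA.
move=> p Fp; have [i' [f' [Ff' pE']]] := hx' p Fp.
have [i [f [Ff pE]]] := hx f' Ff'.
exists (i, i'), f; split => //=.
rewrite mulSn iterD pE' iter_mulA_D pE (iter_mulA_phi R _ (xL' i')).
by rewrite (phiD R (xL i) (Zlaurent_powA k (xL' i'))) addrA.
Qed.

Lemma positive_measure_injective : (0 < mu F)%E ->
  forall k, (1 <= k)%N -> injective (@expansion n (mxA A) D k).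
Proof.
move=> F0 k k1 e1 e2 eE; apply: contrapT => /eqP ne.
have [d [C [c [d0 hd c0 hbd]]]] := tile_measure_bounds hlam hmuB hmuB1.
have [J [v [s [hs cov]]]] := attractor_cover hF d0.
pose N := (a ^ k).-1.
have a0 : (0 < a ^ k)%N by rewrite -card_digit_words; apply/card_gt0P; exists e1.
have reach := @reach_iter k N _.
have {}reach : forall m, exists (T : finType) (x : T -> 'cV[rat]_n.+1), [/\ #|T| = (N ^ m)%N,
    forall i, Zlaurent (mxB A) (x i) &
    forall p, F p -> exists i f, F f /\ iter (m * k) mulA p = f + phi R A (x i)].
  (* The word [e1] is discarded: wherever it occurs, [e2] yields the same translation. *)
  apply: reach; exists {e : {ffun 'I_k -> D} | e != e1}, (fun e => expn (val e)); split.
  - by rewrite /N card_sig -card_digit_words -(cardC1 e1); apply: eq_card => e; rewrite !inE.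
  - by move=> e; exact: expansion_Zlaurent.
  move=> p /(attractor_forward hDA hF k)[e [f [Ff pE]]].
  have [ee|ee] := eqVneq e e1; last by exists (exist _ e ee), f.
  have ne2 : e2 != e1 by rewrite eq_sym.
  by exists (exist _ e2 ne2), f; split => //=; rewrite -eE -ee.
have bound m : exists2 T : R, (a ^ (m * k))%N%:R * T <= C &
    (mu F <= ((N ^ m * #|J|)%N%:R * T)%:E)%E.
  have [T TE /andP[_ TC]] := hbd (m * k)%N; exists T => //.
  have [I [x [hI xL hx]]] := reach m.
  rewrite EFinM -TE -hI -card_prod.
  refine (@measure_cover_le _ _ R mu _ _ _ _ _ _ _ (attractor_sub_tiles hs cov xL hx)).
  - exact: attractor_measurable.
  - by move=> q; exact: measurable_tile.
  - by move=> q; rewrite [leLHS]muA_tile.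
have Ffin : exists2 M : R, mu F = M%:E & 0 < M.
  have [T _] := bound 0%N; move: F0; case: (mu F) => [M| |]//.
  by rewrite lte_fin => M0 _; exists M.
have [M ME M0] := Ffin.
pose t : R := N%:R / (a ^ k)%N%:R.
have ak0 : 0 < (a ^ k)%N%:R :> R by rewrite ltr0n.
have t0 : 0 <= t by rewrite divr_ge0.
have t1 : t < 1 by rewrite ltr_pdivrMr// mul1r ltr_nat /N ltn_predL.
have [m hm] := geometric_small (#|J|%:R * C) t0 t1 M0.
have [T TC] := bound m; rewrite ME lee_fin => MT.
have := hm m (leqnn m); rewrite ltNge => /negP; apply; apply: (le_trans MT).
have akE : (a ^ (m * k))%N%:R = (a ^ k)%N%:R ^+ m :> R by rewrite mulnC expnM natrX.
rewrite akE -ler_pdivlMl ?exprn_gt0// in TC.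
apply: le_trans (ler_wpM2l _ TC) _; first exact: ler0n.
rewrite /t expr_div_n natrM natrX le_eqVlt; apply/orP; left; apply/eqP.
by move: (_^-1) => y; ring.
Qed.

Lemma Dinf_uniformly_discrete : uniformly_discrete (phi R A @` Dinf (mxA A) D).
Proof.
have [d d0 hd] := lattice_separation R A.
(* Two points in one ball differ by less than [d] in each real coordinate and by less than
   [1 = b ^ 0] in the second factor, so their difference lies in [Z^n[B]]. *)
have r0 : 0 < Num.min (d / 2) (1 / 2) by rewrite lt_min !divr_gt0.
have distE (p q : KA R A) : KA_dist p q < Num.min (d / 2) (1 / 2) ->
    enorm (p.1 - q.1) < d / 2 /\ mdist p.2 q.2 < 1 / 2.
  by rewrite gt_max !lt_min => /andP[/andP[-> _] /andP[_ ->]].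
exists (Num.min (d / 2) (1 / 2)) => // c p q [x [k _ [e _ xE]] pE] [y [l _ [e' _ yE]] qE].
move=> /distE[x1 x2] /distE[y1 y2]; rewrite -pE -qE; rewrite -pE -xE in x1 x2.
rewrite -qE -yE in y1 y2; rewrite -xE -yE; congr (phi _ _ _).
apply/eqP; rewrite -subr_eq0; apply/eqP.
have eL := expansion_Zlaurent hDA e; have eL' := expansion_Zlaurent hDA e'.
have enormE (z : V) i : `|z i 0| <= enorm z.
  rewrite -sqrtr_sqr ler_wsqrtr// (bigD1 i)//= lerDl sumr_ge0// => j _.
  exact: sqr_ge0.
apply: hd.
- by apply: ZpolyB; exact: expansion_Zpoly.
- apply/level0E; apply: (iffLR (Yball_emb R 0 (ZlaurentB uB eL eL'))).
  rewrite (ZembB R eL eL'); apply: (iffLR (Yball_mdist 0 _ _)); rewrite oppr0 expr0z.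
  apply: le_trans (metric_triangle _ c.2 _) _; rewrite [X in X + _]metric_sym.
  by rewrite (splitr 1); apply: lerD; apply: ltW; [exact: x2|exact: y2].
move=> i; have := le_lt_trans (enormE _ i) x1; have := le_lt_trans (enormE _ i) y1.
clear x1 x2 y1 y2 distE r0.
rewrite /phi /=; move: (expn e) (expn e') => xe ye; rewrite !mxE rmorphB /=.
move: (ratr (xe i 0)) (ratr (ye i 0)) (c.1 i 0) => u w z.
rewrite !ltr_norml ler_norml => /andP[h1 h2] /andP[h3 h4].
by apply/andP; split; lra.
Qed.

Lemma injective_positive_measure :
  (forall k, (1 <= k)%N -> injective (@expansion n (mxA A) D k)) -> (0 < mu F)%E.
Proof.
move=> inj.
have {}inj k : injective (@expansion n (mxA A) D k).
  case: k => [|k]; last exact: inj.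
  by move=> e e' _; apply/ffunP => -[].
have [d [C [c [d0 hd c0 hbd]]]] := tile_measure_bounds hlam hmuB hmuB1.
have [J [v [s [hs cov]]]] := attractor_cover hF d0.
(* A single tile at the origin per word, instead of a family covering [F]: this makes the tiles of
   one level pairwise disjoint. *)
pose G := @tile_level R n A D d unit (fun=> 0) (fun=> 0).
have G0 : forall j : unit, Zlaurent (mxB A) 0 by move=> _; exact: Zlaurent0.
have [M [j0 [j00 hM]]] := tile_level_near hDA hF d (fun=> 0 : V) G0.
have [K K0 hK] := inv_power_bounded R (@base_expanding n A).
(* Starting at level [|j0|] keeps the second coordinate in the same coset of [Z^n[[B]]] as the
   nearby point of [F], so all levels stay in one bounded set. *)
pose G' k := G (k + `|j0|%N)%N.
have mG k : measurable (G k) by exact: measurable_tile_level.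
have muG k : (c%:E <= mu (G k))%E.
  have [T TE /andP[cT _]] := hbd k.
  rewrite [X in (_ <= X)%E](_ : _ = ((#|{: {ffun 'I_k -> D} * unit}|)%:R%:E * T%:E)%E).
    by rewrite card_prod card_unit muln1 card_digit_words -EFinM lee_fin.
  apply: measure_disjoint_union => [q|q|[e []] [e' []] p pe pe'].
  - exact: measurable_tile.
  - by rewrite -TE; exact: muA_tile.
  congr (_, _); apply: inj.
  have eL := expansion_Zlaurent hDA e; have eL' := expansion_Zlaurent hDA e'.
  apply: (tile_disjoint hd eL eL' (k := k) (p := p)).
  - by apply: ZpolyB; exact: expansion_Zpoly.
  - by move: pe; rewrite /digit_tile_at !add0r.
  - by move: pe'; rewrite /digit_tile_at !add0r.
pose box j : set (borel V * borel Y) :=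
  cbox (const_mx (- (K * M)) + v j) (const_mx (d + K * M) + v j) `*` Ycoset 0 (Zemb R A (s j)).
have G'box : \bigcup_(k >= 0) G' k `<=` \bigcup_(j in [set: J]) box j.
  move=> p [k _ pk]; have [g Fg [g1 g2]] := hM _ p pk.
  have [j [gj1 gj2]] := cov g Fg; exists j => //; split.
    move=> i; have := hK (k + `|j0|)%N _ _ g1 i; rewrite (MB_MA (@base_expanding n A)) ler_norml.
    have := gj1 i; rewrite expr0 mul1mx !mxE => /andP[h1 h2] /andP[h3 h4].
    by apply/andP; split; lra.
  rewrite /Ycoset /= -(subrKA g.2 p.2); apply: YballD => //.
  apply: Yball_le g2; rewrite PoszD addrCA addr_ge0// abszE -lerBlDl sub0r.
  by rewrite -normrN ler_norm.
have mbox j : measurable (box j) by exact: measurable_box.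
have G'fin : (mu (\bigcup_(k >= 0) G' k) < +oo)%E.
  pose cb := mu (cbox (const_mx (- (K * M))) (const_mx (d + K * M)) `*` Ycoset 0 (0 : Y)).
  have hb j : (mu (box j) <= cb)%E.
    rewrite /cb /box !muA_rect ?haar_Ycoset1// ?lebesgue_cbox_shift//;
      try (by apply: borel_closed; exact: closed_cbox); exact: measurable_Ycoset.
  have cbfin : (cb < +oo)%E by exact: muA_box_lty.
  apply: le_lt_trans (measure_cover_le _ mbox hb G'box) _.
    by apply: bigcup_measurable => k _; exact: mG.
  by rewrite lte_mul_pinfty.
(* Reverse Fatou: as the total union has finite measure, the measures of the tail unions decrease to
   that of the upper limit, and each is at least [c]. *)
have cvg := lim_sup_set_cvg mu G' (fun k => mG _) G'fin.
have sup : (c%:E <= mu (lim_sup_set G'))%E.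
  rewrite -(cvg_lim _ cvg)//; apply: lime_ge; first by apply/cvg_ex; eexists; exact: cvg.
  near=> m; apply: le_trans (muG (m + `|j0|%N)%N) _.
  apply: le_measure; rewrite ?inE.
  - exact: mG.
  - by apply: bigcup_measurable => k _; exact: mG.
  by move=> p pm; exists m => /=.
apply: lt_le_trans (_ : (0 < c%:E)%E) _; first by rewrite lte_fin.
apply: (le_trans sup); apply: le_measure; rewrite ?inE.
- apply: bigcap_measurable => // i _; apply: bigcup_measurable => j _; exact: mG.
- exact: attractor_measurable.
move=> p ph; apply: (lim_sup_level_sub hDA hF G0 (v := fun=> 0) (d := d)).
move=> m _; have [k /= mk pk] := ph m Logic.I.
by exists (k + `|j0|%N)%N => //=; rewrite (leq_trans mk)// leq_addr.
Unshelve. all: by end_near. Qed.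

End PositiveMeasure.

Theorem theorem3p2 (R : realType) (n : nat)
    (A : 'M[rat]_n.+1) (D : {fset 'cV[rat]_n.+1})
    (hD : digit_system A D) (hb : (2 <= quot_card A^-1)%N)
    (lam : {measure set (borel 'cV[R]_n.+1) -> \bar R})
    (hlam : is_lebesgue lam)
    (muB : {measure set (borel (Zcompl R (digit_base hD hb))) -> \bar R})
    (hmuB : is_haar muB)
    (hmuB1 : muB (@Zintegral R n (digit_base hD hb)) = 1%E)
    (F : set (KA R (digit_base hD hb)))
    (hF : digit_tile D F) :
  (0 < (lam \x muB) F)%E <->
  (forall k : nat, (1 <= k)%N -> injective (@expansion n A D k)) /\
  uniformly_discrete (phi R (digit_base hD hb) @` Dinf A D).
Proof.
have [_ hDA hDa] := hD.
split=> [F0|[inj _]].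
  split; last exact: (@Dinf_uniformly_discrete R n (digit_base hD hb) D hDA).
  exact: (positive_measure_injective hlam (hmuB := hmuB) (hmuB1 := hmuB1) hDA hDa hF).
exact: (injective_positive_measure hlam hmuB hmuB1 hDA hDa hF).
Qed.
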